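(* Let $\Gamma=\mathbb F_r$ and let $\varepsilon_c=\varepsilon_c(r)$ be the constant defined below. If $0<\varepsilon<\varepsilon_c$, then the product self-joining $\mathrm{Is}_\varepsilon\times\mathrm{Is}_\varepsilon$ does not maximize the $f$-invariant among self-joinings of $\mathrm{Is}_\varepsilon$: there is $\lambda\in\mathcal J(\mathrm{Is}_\varepsilon,\mathrm{Is}_\varepsilon)$ with $f(\lambda)>f(\mathrm{Is}_\varepsilon\times\mathrm{Is}_\varepsilon)$.
   Context: $\Gamma=\mathbb F_r$ is the free group on $s_1,\dots,s_r$. For a finite set $V$ and $\sigma\in\mathrm{Hom}(\mathbb F_r,\mathrm{Sym}(V))$ (write $\sigma^\gamma=\sigma(\gamma)$), the graph of $\sigma$ is the multigraph with one edge $\{v,\sigma^{s_i}v\}$ for each $v\in V$, $i\in[r]$ (so $|V|r$ edges). For $\mathbf x\in\mathtt A^V$, $\Pi^\sigma_v\mathbf x=(\mathbf x(\sigma^\gamma v))_{\gamma\in\Gamma}$, $P^\sigma_{\mathbf x}=\frac1{|V|}\sum_v\delta_{\Pi^\sigma_v\mathbf x}$, $\Omega(\sigma,\mathcal O)=\{\mathbf x:P^\sigma_{\mathbf x}\in\mathcal O\}$. Let $\sigma_n\in\mathrm{Hom}(\mathbb F_r,\mathrm{Sym}([n]))$ be uniformly random (i.e. $\sigma_n^{s_1},\dots,\sigma_n^{s_r}$ independent uniform permutations). For a shift-invariant probability measure $\mu$ on $\mathtt A^\Gamma$ ($\mathtt A$ finite, shift $(\beta\mathbf x)(\gamma)=\mathbf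 x(\gamma\beta)$), the $f$-invariant is $f(\mu)=\inf_{\mathcal O\ni\mu}\limsup_{n}\frac1n\log\mathbb E|\Omega(\sigma_n,\mathcal O)|$ (infimum over weak* open neighborhoods). $\mathcal J(\mu,\mu)$ is the set of shift-invariant measures on $(\mathtt A\times\mathtt A)^\Gamma$ with both marginals $\mu$. For $\varepsilon\in(0,1/2]$, $\mathrm{Is}_\varepsilon$ is the free-boundary Ising measure: the law of the $\{-1,+1\}$-valued, $\Gamma$-indexed stationary Markov chain on the Cayley tree with uniform single-site marginal and transition matrix $\begin{pmatrix}1-\varepsilon&\varepsilon\\ \varepsilon&1-\varepsilon\end{pmatrix}$ across each edge. A bisection of a finite vertex set $V$ is a partition $V=V_1\sqcup V_2$ with $||V_1|-|V_2||\le1$; its cut size is the number of edges of the graph with endpoints in different parts; $\mathsf{mcut}(\sigma)$ is the minimum cut size over bisections of the graph of $\sigma$. The constant $\varepsilon_c=\varepsilon_c(r)$ is defined as the limit in probability of $\mathsf{mcut}(\sigma_n)/(rn)$ as $n\to\infty$ (its existence, and $\varepsilon_c=\frac12-\mathsf P_*\frac1{\sqrt{2r}}+o_r(r^{-1/2})$ with $\mathsf P_*\approx0.7632$ the Parisi ground-state energy constant of the Sherrington–Kirkpatrick model, is due to Dembo–Montanari–Sen). *)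

(* Defs.v *)
From HB Require Import structures.
From mathcomp Require Import all_boot all_order all_algebra all_fingroup.
From mathcomp Require Import all_classical all_reals all_analysis.
Set Implicit Arguments. Unset Strict Implicit. Unset Printing Implicit Defensive.
Import Order.TTheory GRing.Theory Num.Theory.
Local Open Scope ring_scope.

(* A letter (i, b): b = false means s_i, b = true means s_i^-1. *)
Definition letter (r : nat) := ('I_r * bool)%type.
Definition word (r : nat) := seq (letter r).

Definition cancels r (l1 l2 : letter r) : bool := (l1.1 == l2.1) && (l1.2 != l2.2).

Fixpoint reduced r (w : word r) : bool :=
  match w with
  | l1 :: ((l2 :: _) as w') => ~~ cancels l1 l2 && reduced w'
  | _ => true
  end.

Definition lmul r (l : letter r) (w : word r) : word r :=
  match w with
  | l' :: w' => if cancels l l' then w' else l :: l' :: w'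
  | [::] => [:: l]
  end.

Definition red r (w : word r) : word r := foldr (@lmul r) [::] w.

Lemma reduced_lmul r (l : letter r) (w : word r) : reduced w -> reduced (lmul l w).
Proof.
case: w => [|l' w] //= H.
case: ifP => Hc.
  by case: w H => [|l2 w2] //= /andP[].
by rewrite /reduced -/reduced Hc H.
Qed.

Lemma reduced_red r (w : word r) : reduced (red w).
Proof. by elim: w => [|l w IH] //=; apply: reduced_lmul. Qed.

Definition FG (r : nat) := {w : word r | reduced w}.

Definition FGmul r (a b : FG r) : FG r :=
  exist _ (red (val a ++ val b)) (reduced_red _).

(* A cylinder constraint list c : cyl r A describes the event
   {x in A^Gamma | x gamma = a for all (gamma, a) in c}.  A Borel probability
   measure on A^Gamma is represented by its values on these events. *)
Definition cyl (r : nat) (A : eqType) := seq (FG r * A)%type.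

Section Measures.
Variables (R : realType) (r : nat) (A : finType).

(* m is (the cylinder function of) a Borel probability measure on A^Gamma:
   by Kolmogorov's extension theorem these are exactly the consistent
   families below. *)
Definition is_prob_meas (m : cyl r A -> R) : Prop :=
  [/\ forall c, 0 <= m c,
      m [::] = 1,
      forall c g, m c = \sum_(a : A) m ((g, a) :: c)
    & forall c1 c2, c1 =i c2 -> m c1 = m c2].

(* shift (beta x)(gamma) = x(gamma beta); invariance of the measure *)
Definition shift_invariant (m : cyl r A -> R) : Prop :=
  forall (beta : FG r) (c : cyl r A),
    m [seq (FGmul p.1 beta, p.2) | p <- c] = m c.
End Measures.

Section Joinings.
Variables (R : realType) (r : nat) (A : finType).

Fixpoint marg1_aux (lam : cyl r (A * A)%type -> R) (c : cyl r A)
    (acc : cyl r (A * A)%type) : R :=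
  match c with
  | [::] => lam acc
  | p :: c' => \sum_(b : A) marg1_aux lam c' ((p.1, (p.2, b)) :: acc)
  end.
Fixpoint marg2_aux (lam : cyl r (A * A)%type -> R) (c : cyl r A)
    (acc : cyl r (A * A)%type) : R :=
  match c with
  | [::] => lam acc
  | p :: c' => \sum_(b : A) marg2_aux lam c' ((p.1, (b, p.2)) :: acc)
  end.
Definition marg1 lam (c : cyl r A) := marg1_aux lam c [::].
Definition marg2 lam (c : cyl r A) := marg2_aux lam c [::].

Definition prod_meas (mu nu : cyl r A -> R) (c : cyl r (A * A)%type) : R :=
  mu [seq (p.1, p.2.1) | p <- c] * nu [seq (p.1, p.2.2) | p <- c].

Definition joining (lam : cyl r (A * A)%type -> R) (mu nu : cyl r A -> R) : Prop :=
  [/\ is_prob_meas lam, shift_invariant lam,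
      forall c, marg1 lam c = mu c & forall c, marg2 lam c = nu c].
End Joinings.

Section Sofic.
Variables (R : realType) (r : nat).

(* sigma in Hom(F_r, Sym([n])) is determined by the images of s_1..s_r *)
Definition hom (n : nat) := {ffun 'I_r -> {perm 'I_n}}.

Definition act n (s : hom n) (g : FG r) (v : 'I_n) : 'I_n :=
  foldr (fun (l : letter r) v => if l.2 then ((s l.1)^-1)%g v else s l.1 v) v (val g).

Section Alphabet.
Variable A : finType.

Definition emp n (s : hom n) (x : {ffun 'I_n -> A}) (c : cyl r A) : R :=
  (#|[set v : 'I_n | all (fun p => x (act s p.1 v) == p.2) c]|)%:R / n%:R.

(* basic weak* neighbourhood of mu given by finitely many cylinders cs and
   radius d:  O = {nu | |nu(C) - mu(C)| < d for all C in cs};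
   membership of P^sigma_x in O *)
Definition in_nbhd (mu : cyl r A -> R) (cs : seq (cyl r A)) (d : R)
    n (s : hom n) (x : {ffun 'I_n -> A}) : bool :=
  all (fun c => `|emp s x c - mu c| < d) cs.

Definition expOmega (mu : cyl r A -> R) cs d n : R :=
  (\sum_(s : hom n) #|[set x : {ffun 'I_n -> A} | in_nbhd mu cs d s x]|)%:R
    / (#|{: hom n}|)%:R.

Definition rate (mu : cyl r A -> R) cs d (n : nat) : \bar R :=
  let E := expOmega mu cs d n in
  if E == 0 then -oo%E else ((ln E) / n%:R)%:E.

Definition f_inv (mu : cyl r A -> R) : \bar R :=
  ereal_inf [set limn_esup (rate mu cs d) | cs in [set: seq (cyl r A)] & d in [set d : R | 0 < d]].
End Alphabet.

Definition cut_size n (s : hom n) (V1 : {set 'I_n}) : nat :=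
  #|[set p : 'I_n * 'I_r | (p.1 \in V1) != (s p.2 p.1 \in V1)]|.

Definition is_bisection n (V1 : {set 'I_n}) : bool :=
  (#|V1| <= (n - #|V1|).+1)%N && (n - #|V1| <= #|V1|.+1)%N.

Definition mcut n (s : hom n) : nat :=
  \big[minn/(r * n)%N]_(V1 : {set 'I_n} | is_bisection V1) cut_size s V1.

Definition is_eps_c (ec : R) : Prop :=
  forall eta theta : R, 0 < eta -> 0 < theta ->
  exists N : nat, forall n : nat, (N <= n)%N ->
    (#|[set s : hom n | eta < `|(mcut s)%:R / (r * n)%:R - ec|]|)%:R
      / (#|{: hom n}|)%:R <= theta.
End Sofic.

(* spins: true = +1, false = -1 *)
Section Ising.
Variables (R : realType) (r : nat) (eps : R).

Definition trans (a b : bool) : R := if a == b then 1 - eps else eps.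

Definition agree (c : cyl r bool) (w : word r) (a : bool) : R :=
  if all (fun p => (val p.1 == w) ==> (p.2 == a)) c then 1 else 0.

(* likelihood of the constraints in the subtree below w (depth k), spin a at w.
   Edges of the Cayley tree are {gamma, s gamma} (left multiplication), matching
   the graph of sigma; the children of w are l :: w for reduced l :: w. *)
Fixpoint lik (c : cyl r bool) (k : nat) (w : word r) (a : bool) : R :=
  agree c w a *
  match k with
  | 0 => 1
  | k'.+1 => \prod_(l : letter r | reduced (l :: w))
               \sum_(b : bool) trans a b * lik c k' (l :: w) b
  end.

Definition Ising (c : cyl r bool) : R :=
  let K := \max_(p <- c) size (val p.1) in
  \sum_(a : bool) 2^-1 * lik c K [::] a.
End Ising.

(* Main.v *)
Require Import Defs.
From HB Require Import structures.
From mathcomp Require Import all_boot all_order all_algebra all_fingroup.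
From mathcomp Require Import all_classical all_reals all_analysis.
From mathcomp Require Import zify ring lra.
Set Implicit Arguments. Unset Strict Implicit. Unset Printing Implicit Defensive.
Import Order.TTheory GRing.Theory Num.Theory.
(* mathcomp also exports a [hom] (vector) and an [act] (action). *)
Import Defs.
Import numFieldNormedType.Exports.
Local Open Scope ring_scope.

(** Suppose every self-joining [lam] had [f lam <= 2F], where
    [F = (1 - r) ln 2 + r h(eps)] ([h] the binary entropy) is the value of
    [f] at the Ising measure.  Let [Z] be the number of good colourings of
    [sigma_n], i.e. exactly balanced ones whose empirical measure is close to
    the Ising measure.  By compactness the second moment [E Z^2] grows at a
    rate at most [sup_lam f lam <= 2F], and the first moment [E Z] grows at
    rate at least [F], so [P(Z > 0)] does not decay exponentially.  But a good
    colouring is a bisection cutting a fraction about [eps < epsc] of the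
    edges, and [mcut] is concentrated near [epsc r n] with exponentially small
    error: contradiction.

    The first moment is computed exactly: for rational [eps] and [n] a multiple
    of the common denominator, count the labellings of the vertices by
    configurations on the ball of radius [k] which have exactly the type
    prescribed by the Ising measure, edge by edge.  Such a labelling is
    determined by the spins, and its entropy is [F] for every [k].  The bound
    [f (Is x Is) <= 2F] only uses the statistics of single edges. *)

(** * Types of colourings and Stirling bounds *)

(** [is_eps_c] is only convergence in probability, whereas good colourings might live on
    exponentially rare [sigma_n]; the exponential lower tail is therefore proved, by a
    martingale-type argument along a random shuffle. Its rate [c] fixes the gain: (E Z)^2 <= P(Z >
    0) E Z^2 and P(Z > 0) <= exp(-c n) force E Z^2 to have rate at least 2F + c/2, and the joining
    obtained has [f] at least that large. No subsequence is extracted: the sets of empirical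
    measures with negligible contribution to E Z^2 form an ideal, and the joining is a cluster point
    of the dual filter. The first moment bound holds only along multiples of a denominator. This
    suffices, because the tail bound and negligibility hold for all large [n]. Prescribing exact
    types turns the probability that a permutation realizes a pair type into an identity. The
    entropy is the same for every radius because the overlaps of neighbouring balls, summed over the
    generators, have as many elements as the ball has edges. *)

Section Stirling.
Variable R : realType.
Implicit Types (n : nat) (x d : R).

Lemma ln_natS_sub_le n : n%:R * (ln n.+1%:R - ln n%:R) <= 1 :> R.
Proof.
case: n => [|n]; first by rewrite mul0r.
have n0 : 0 < n.+1%:R :> R by rewrite ltr0n.
have -> : ln n.+2%:R - ln n.+1%:R = ln (1 + n.+1%:R^-1) :> R.
  rewrite -ln_div ?posrE ?ltr0n//; congr ln.
  by rewrite -(natr1 n.+1) mulrDl divff ?gt_eqF// mul1r.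
rewrite mulrC -ler_pdivlMr// mul1r le_ln1Dx//.
by rewrite (lt_le_trans _ (_ : 0 <= _)) ?ltrN10 ?invr_ge0 ?ler0n.
Qed.

Lemma lnfact_ge n : n%:R * ln n%:R - n%:R <= ln n`!%:R :> R.
Proof.
elim: n => [|n IH]; first by rewrite mul0r subr0 fact0 ln1.
rewrite factS natrM lnM ?posrE ?ltr0n ?fact_gt0//.
have := ln_natS_sub_le n; move: IH; rewrite -(natr1 n); set a := ln _; lra.
Qed.

Lemma lnfact_le n : ln n`!%:R <= n%:R * ln n%:R - n%:R + (ln n.+1%:R + 1) :> R.
Proof.
(* This sharper closed form is the one that passes through the induction. *)
suff H : ln n`!%:R <= n.+1%:R * ln n.+1%:R - n%:R :> R.
  apply: (le_trans H); have := ln_natS_sub_le n.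
  rewrite -(natr1 n); set a := ln _; lra.
elim: n => [|n IH]; first by rewrite fact0 ln1 mulr0 subr0.
rewrite factS natrM lnM ?posrE ?ltr0n ?fact_gt0//.
have n0 : 0 < n.+2%:R :> R by rewrite ltr0n.
have H : ln n.+1%:R - ln n.+2%:R <= - n.+2%:R^-1 :> R.
  have -> : ln n.+1%:R - ln n.+2%:R = ln (1 + (- n.+2%:R^-1)) :> R.
    rewrite -ln_div ?posrE ?ltr0n//; congr ln.
    by apply: (mulIf (lt0r_neq0 n0)); rewrite divfK ?gt_eqF// mulrDl mulNr mulVf ?gt_eqF// mul1r -(natr1 n.+1) addrK.
  by rewrite le_ln1Dx// ltrN2 invf_lt1// ltr1n.
have H2 : 1 <= n.+2%:R * (ln n.+2%:R - ln n.+1%:R) :> R.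
  by rewrite mulrC -ler_pdivrMr// mul1r -opprB lerNr.
move: IH H2; rewrite -(natr1 n.+1); set a := ln _; set b := ln _.
by rewrite -(natr1 n); nra.
Qed.

Lemma ln_natS_sublinear d : 0 < d ->
  exists N, forall n, (N <= n)%N -> ln n.+1%:R + 1 <= d * n%:R.
Proof.
move=> d0; have d20 : 0 < d / 2 by rewrite divr_gt0.
(* The threshold comes from ln x <= x - 1 at x = (d/2)(n+1). *)
exists (Num.truncn ((d / 2 - ln (d / 2)) / (d / 2))).+1 => n Nn.
have H : (d / 2 - ln (d / 2)) / (d / 2) < n%:R.
  by apply: lt_le_trans (truncnS_gt _) _; rewrite ler_nat.
move: H; rewrite ltr_pdivrMr// => H.
have pos : 0 < d / 2 * n.+1%:R by rewrite mulr_gt0 ?ltr0n.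
have : ln (1 + (d / 2 * n.+1%:R - 1)) <= d / 2 * n.+1%:R - 1.
  by apply: le_ln1Dx; move: pos; lra.
rewrite (addrC 1) subrK lnM ?posrE ?ltr0n//; move: H; rewrite -(natr1 n).
set a := ln (d / 2); set b := ln _; nra.
Qed.

End Stirling.

Section Types.
Variable Y : finType.

Definition cnt (I : finType) (x : I -> Y) (a : Y) : nat := #|[set v | x v == a]|.

Lemma cntE (I : finType) (x : I -> Y) a : cnt x a = (\sum_v (x v == a))%N.
Proof. by rewrite /cnt cardsE -sum1_card big_mkcond. Qed.

Lemma sum_cnt (I : finType) (x : I -> Y) : (\sum_a cnt x a = #|I|)%N.
Proof.
under eq_bigr do rewrite cntE; rewrite exchange_big /= -sum1_card.
apply: eq_bigr => v _; rewrite (bigD1 (x v))//= eqxx big1 ?addn0// => a.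
by rewrite eq_sym => /negPf->.
Qed.

(** The multinomial coefficient, written without division; the induction splits on the first
    letter. *)
Lemma card_tuple_type n (N : Y -> nat) : (\sum_a N a = n)%N ->
  (#|[set t : n.-tuple Y | [forall a, count_mem a t == N a]]| * \prod_a (N a)`! = n`!)%N.
Proof.
elim: n N => [|n IH] N sN.
  have N0 a : N a = 0%N.
    by apply/eqP; rewrite -leqn0 -sN (bigD1 a)//= leq_addr.
  rewrite big1 ?muln1 => [|a _]; last by rewrite N0.
  rewrite (_ : [set _ | _] = [set: _]) ?cardsT ?card_tuple ?expn0//.
  by apply/setP => t; rewrite !inE; apply/forallP => a; rewrite N0 tuple0.
have bijc : bijective (fun p : Y * n.-tuple Y => cons_tuple p.1 p.2).
  exists (fun t => (thead t, behead_tuple t)) => [[a t]|t].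
    by congr pair; apply: val_inj.
  by rewrite [in RHS](tuple_eta t); apply: val_inj.
have -> : #|[set t : n.+1.-tuple Y | [forall a, count_mem a t == N a]]| =
    (\sum_a #|[set t : n.-tuple Y | [forall b, ((a == b) + count_mem b t)%N == N b]]|)%N.
  rewrite -sum1dep_card (reindex _ (onW_bij _ bijc))/=.
  rewrite -(pair_big_dep xpredT (fun a (t : n.-tuple Y) => [forall b, ((a == b) + count_mem b t)%N == N b])
    (fun _ _ => 1%N))/=.
  by apply: eq_bigr => a _; rewrite sum1dep_card.
rewrite big_distrl/= factS -[in RHS]sN big_distrl/=; apply: eq_bigr => a _.
have [Na0|Na0] := posnP (N a).
  rewrite Na0 mul0n (_ : #|_| = 0%N)//.
  apply: eq_card0 => t; rewrite !inE; apply/negbTE; rewrite negb_forall; apply/existsP; exists a.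
  by rewrite /= eqxx Na0.
pose N' b := (N b - (a == b))%N.
have NN' b : N b = ((a == b) + N' b)%N.
  by rewrite /N' subnKC//; case: eqP => [<-|].
have sN' : (\sum_b N' b = n)%N.
  move: sN; under eq_bigr do rewrite NN'.
  rewrite big_split/= (bigD1 a)//= eqxx big1 => [|b]; first by rewrite addn0 add1n => -[].
  by rewrite eq_sym => /negPf->.
rewrite -(IH _ sN') mulnCA; congr muln.
  apply: eq_card => t; rewrite !inE; apply: eq_forallb => b.
  by rewrite NN' eqn_add2l.
rewrite (bigD1 a)//= [in RHS](bigD1 a)//= mulnA; congr muln.
  by rewrite {1 2}(NN' a) eqxx add1n factS.
by apply: eq_bigr => b ba; rewrite NN' eq_sym (negPf ba).
Qed.

Definition typed n (N : Y -> nat) := [set x : {ffun 'I_n -> Y} | [forall a, cnt x a == N a]].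

Lemma count_codom n (x : {ffun 'I_n -> Y}) a : count_mem a (codom x) = cnt x a.
Proof.
rewrite cntE -sum1_count big_map big_enum_cond big_mkcond/=.
by apply: eq_bigr => i _; case: eqP.
Qed.

Lemma card_typed n (N : Y -> nat) : (\sum_a N a = n)%N ->
  (#|typed n N| * \prod_a (N a)`! = n`!)%N.
Proof.
move=> /card_tuple_type <-; congr muln.
pose h (x : {ffun 'I_n -> Y}) := [tuple x i | i < n].
have hK : injective h.
  move=> x y E; apply/ffunP => i.
  by have := congr1 (fun t => tnth t i) E; rewrite !tnth_mktuple.
have hc x a : count_mem a (h x) = cnt x a by exact: count_codom.
have hS t : h [ffun i => tnth t i] = t.
  by apply: eq_from_tnth => i; rewrite tnth_mktuple ffunE.
rewrite -(card_imset _ hK); apply: eq_card => t; rewrite inE; apply/imsetP/forallP.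
  by move=> [x]; rewrite inE => /forallP xN -> a; rewrite hc.
move=> tN; exists [ffun i => tnth t i]; last by rewrite hS.
by rewrite inE; apply/forallP => a; rewrite -hc hS.
Qed.

Lemma card_typed_gt0 n (N : Y -> nat) : (\sum_a N a = n)%N -> (0 < #|typed n N|)%N.
Proof. by move=> /card_typed; case: #|_| => //; rewrite mul0n => /esym/eqP; rewrite -leqn0 leqNgt fact_gt0. Qed.

Section Asymptotics.
Variable R : realType.

(* [n] times the entropy of the distribution [N / n]; recall [ln 0 = 0]. *)
Definition type_entropy n (N : Y -> nat) : R := \sum_a (N a)%:R * (ln n%:R - ln (N a)%:R).

Lemma ln_card_typed n (N : Y -> nat) : (\sum_a N a = n)%N ->
  ln #|typed n N|%:R = ln n`!%:R - \sum_a ln (N a)`!%:R :> R.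
Proof.
move=> sN; rewrite -(card_typed sN) natrM lnM ?posrE ?ltr0n ?card_typed_gt0//; last first.
  by rewrite prodn_gt0// => a; rewrite fact_gt0.
suff [_ ->] : 0 < (\prod_a (N a)`!)%N%:R :> R /\
    ln (\prod_a (N a)`!)%N%:R = \sum_a ln (N a)`!%:R :> R by rewrite addrK.
rewrite natr_prod; elim/big_rec2 : _ => [|a y1 y2 _ [y10 <-]].
  by rewrite ln1 ltr01.
by rewrite lnM ?posrE ?ltr0n ?fact_gt0// mulr_gt0 ?ltr0n ?fact_gt0.
Qed.

Let type_entropyE n (N : Y -> nat) : (\sum_a N a = n)%N ->
  type_entropy n N = (n%:R * ln n%:R - n%:R) - \sum_a ((N a)%:R * ln (N a)%:R - (N a)%:R).
Proof.
move=> sN; rewrite /type_entropy sumrB -!natr_sum sN.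
under eq_bigr do rewrite mulrBr; rewrite sumrB -mulr_suml -natr_sum sN; lra.
Qed.

Lemma ln_card_typed_le n (N : Y -> nat) : (\sum_a N a = n)%N ->
  ln #|typed n N|%:R <= type_entropy n N + (ln n.+1%:R + 1).
Proof.
move=> sN; rewrite ln_card_typed// type_entropyE//.
have : \sum_a ((N a)%:R * ln (N a)%:R - (N a)%:R) <= \sum_a ln (N a)`!%:R :> R.
  by apply: ler_sum => a _; exact: lnfact_ge.
have := lnfact_le R n; lra.
Qed.

(** Only the upper Stirling bound has an error term, and here it is applied to every letter; in the
    upper bound it is applied to [n!] alone. *)
Lemma ln_card_typed_ge n (N : Y -> nat) : (\sum_a N a = n)%N ->
  type_entropy n N - #|Y|%:R * (ln n.+1%:R + 1) <= ln #|typed n N|%:R.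
Proof.
move=> sN; rewrite ln_card_typed// type_entropyE//.
have : \sum_a ln (N a)`!%:R <=
    \sum_a ((N a)%:R * ln (N a)%:R - (N a)%:R + (ln n.+1%:R + 1)) :> R.
  apply: ler_sum => a _; apply: (le_trans (lnfact_le _ _)).
  rewrite lerD2l lerD2r ler_ln ?posrE ?ltr0n// ler_nat ltnS -sN (bigD1 a)//=.
  exact: leq_addr.
rewrite big_split/= sumr_const -mulr_natl; have := lnfact_ge R n.
rewrite (_ : #|[pred _ | true]| = #|Y|)//; lra.
Qed.

End Asymptotics.
End Types.

(** * Permutations realizing a prescribed pair type *)

Section PermCount.
Variables (Y : finType) (n : nat).
Implicit Types (x y : {ffun 'I_n -> Y}) (s t : 'S_n).

Definition pairf x s : {ffun 'I_n -> Y * Y} := [ffun v => (x v, x (s v))].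

Lemma cnt_perm (Z : finType) (f : 'I_n -> Z) s a : cnt (fun v => f (s v)) a = cnt f a.
Proof. by rewrite !cntE [in RHS](reindex_inj (@perm_inj _ s)). Qed.

Lemma same_type_perm x y : (forall a, cnt x a = cnt y a) ->
  exists s, forall v, y v = x (s v).
Proof.
move=> xy; have : perm_eq (codom y) (codom x).
  by apply/allP => a _ /=; rewrite !count_codom xy.
have -> : codom x = [tuple x i | i < n] by [].
move=> /tuple_permP[s Hs]; exists s => v.
have : nth (y v) (codom y) v = y v.
  by rewrite (nth_map v) ?size_enum_ord// nth_ord_enum.
by rewrite Hs (nth_map v) ?size_enum_ord// nth_ord_enum tnth_mktuple => <-.
Qed.

Definition matching x y := [set s : 'S_n | [ffun v => x (s v)] == y].

Lemma card_matching_le x y (z : {ffun 'I_n -> Y}) : (forall a, cnt y a = cnt z a) ->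
  (#|matching x y| <= #|matching x z|)%N.
Proof.
move=> /same_type_perm[b bE].
rewrite -(card_imset _ (mulgI b)); apply: subset_leq_card.
apply/fintype.subsetP => _ /imsetP[s + ->]; rewrite !inE => /eqP sE; apply/eqP/ffunP => v.
by rewrite ffunE permM bE -sE ffunE.
Qed.

(** The map sending [s] to [x] composed with [s] has all its fibres over the type class of [x] of
    equal size, by [card_matching_le] used both ways. *)
Lemma card_matching (N : Y -> nat) x y : x \in typed n N -> y \in typed n N ->
  (#|typed n N| * #|matching x y| = n`!)%N.
Proof.
move=> xN yN; have typ z : z \in typed n N -> forall a, cnt z a = N a.
  by rewrite inE => /forallP H a; exact/eqP.
rewrite -[RHS](card_Sn n) -[RHS]sum1_card.
rewrite (partition_big (fun s : 'S_n => [ffun v => x (s v)]) (mem (typed n N)))/=; last first.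
  move=> s _; rewrite inE; apply/forallP => a.
  rewrite -(typ _ xN) -(cnt_perm x s); apply/eqP.
  by rewrite !cntE; apply: eq_bigr => v _; rewrite ffunE.
rewrite -sum_nat_const; apply: eq_bigr => z zN; rewrite sum1dep_card.
rewrite -/(matching x z); apply/eqP; rewrite eqn_leq.
by rewrite !card_matching_le// => a; rewrite !typ.
Qed.

(* Both sides count the pairs (alpha, beta) of permutations for which
   v |-> (x (alpha v), x (beta v)) has type N. *)
Lemma card_perm_typed (p : Y -> nat) (N : Y * Y -> nat) x :
  x \in typed n p ->
  (forall a, \sum_b N (a, b) = p a)%N -> (forall b, \sum_a N (a, b) = p b)%N ->
  (#|[set s | pairf x s \in typed n N]| * #|typed n p| ^ 2 = n`! * #|typed n N|)%N.
Proof.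
move=> xp row col; pose e (s t : 'S_n) : {ffun 'I_n -> Y * Y} := [ffun v => (x (s v), x (t v))].
have e1 : (\sum_s \sum_t (e s t \in typed n N) =
           n`! * #|[set s | pairf x s \in typed n N]|)%N.
  rewrite -(card_Sn n) -sum_nat_const; apply: eq_big => [s|s _]; first by rewrite inE.
  (* Products of permutations apply the left factor first, so [e s (s * t)] is [pairf x t]
     precomposed with [s], which has the same type. *)
  rewrite (reindex_inj (mulgI s))/= -sum1dep_card [RHS]big_mkcond/=; apply: eq_bigr => t _.
  rewrite (_ : (e _ _ \in _) = (pairf x t \in typed n N)); first by case: (_ \in _).
  rewrite !inE; apply: eq_forallb => a; rewrite -(cnt_perm (pairf x t) s).
  by congr (_ == _); rewrite !cntE; apply: eq_bigr => v _; rewrite !ffunE permM.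
pose f1 (g : {ffun 'I_n -> Y * Y}) : {ffun 'I_n -> Y} := [ffun v => (g v).1].
pose f2 (g : {ffun 'I_n -> Y * Y}) : {ffun 'I_n -> Y} := [ffun v => (g v).2].
have f1p g : g \in typed n N -> f1 g \in typed n p.
  rewrite !inE => /forallP gN; apply/forallP => a; rewrite -row; apply/eqP.
  under [RHS]eq_bigr do rewrite -(eqP (gN _)) cntE.
  rewrite cntE exchange_big/=; apply: eq_bigr => v _; rewrite ffunE.
  case: (g v) => c d /=; rewrite (bigD1 d)//= big1 => [|b bd]; rewrite xpair_eqE ?eqxx ?andbT ?addn0//.
  by rewrite (eq_sym d) (negPf bd) andbF.
have f2p g : g \in typed n N -> f2 g \in typed n p.
  rewrite !inE => /forallP gN; apply/forallP => a; rewrite -col; apply/eqP.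
  under [RHS]eq_bigr do rewrite -(eqP (gN _)) cntE.
  rewrite cntE exchange_big/=; apply: eq_bigr => v _; rewrite ffunE.
  case: (g v) => c d /=; rewrite (bigD1 c)//= big1 => [|b bd]; rewrite xpair_eqE ?eqxx ?addn0//.
  by rewrite (eq_sym c) (negPf bd).
have e2 : (\sum_s \sum_t (e s t \in typed n N) =
           \sum_(g in typed n N) #|matching x (f1 g)| * #|matching x (f2 g)|)%N.
  have prodE g : (#|matching x (f1 g)| * #|matching x (f2 g)| =
      \sum_s \sum_t ((s \in matching x (f1 g)) && (t \in matching x (f2 g))))%N.
    rewrite -!sum1_card big_distrl/= [LHS]big_mkcond/=; apply: eq_bigr => s _.
    case: ifP => _ /=; last by rewrite big1.
    by rewrite mul1n big_mkcond/=; apply: eq_bigr => t _; case: ifP.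
  under [RHS]eq_bigr do rewrite prodE.
  rewrite [RHS]exchange_big/=; apply: eq_bigr => s _.
  rewrite [RHS]exchange_big/=; apply: eq_bigr => t _.
  rewrite big_mkcond (bigD1 (e s t))//= big1 ?addn0.
    case: ifP => // _; rewrite !inE (_ : _ && _ = true)//.
    by apply/andP; split; apply/eqP/ffunP => v; rewrite !ffunE.
  move=> g gne; case: ifP => // _; rewrite !inE; case: andP => // -[/eqP E1 /eqP E2].
  case/negP: gne; apply/eqP/ffunP => v.
  have := congr1 (fun h : {ffun 'I_n -> Y} => h v) E1.
  have := congr1 (fun h : {ffun 'I_n -> Y} => h v) E2.
  by rewrite !ffunE => -> ->; case: (g v).
have Dxx g : g \in typed n N -> (#|typed n p| * #|matching x (f1 g)| = n`!)%N /\
    (#|typed n p| * #|matching x (f2 g)| = n`!)%N.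
  by move=> gN; split; apply: card_matching => //; [exact: f1p|exact: f2p].
apply/eqP; rewrite -(eqn_pmul2l (fact_gt0 n)) mulnA -e1 e2 big_distrl/=; apply/eqP.
rewrite (eq_bigr (fun=> n`! * n`!)%N); last first.
  by move=> g /Dxx[E1 E2]; rewrite -{1}E1 -E2; ring.
by rewrite sum_nat_const; ring.
Qed.

Lemma perm_typed_prob (R : realType) (p : Y -> nat) (N : Y * Y -> nat) x :
  (\sum_a p a = n)%N -> x \in typed n p ->
  (forall a, \sum_b N (a, b) = p a)%N -> (forall b, \sum_a N (a, b) = p b)%N ->
  #|[set s | pairf x s \in typed n N]|%:R / n`!%:R =
  #|typed n N|%:R / #|typed n p|%:R ^+ 2 :> R.
Proof.
move=> sp xp row col; have := card_perm_typed xp row col.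
move=> /(congr1 (fun k => k%:R : R)); rewrite !natrM => E.
have p0 : #|typed n p|%:R != 0 :> R by rewrite pnatr_eq0 -lt0n card_typed_gt0.
have n0 : n`!%:R != 0 :> R by rewrite pnatr_eq0 -lt0n fact_gt0.
by apply/eqP; rewrite eqr_div ?expf_neq0// expr2 E mulrC.
Qed.

End PermCount.

Section Entropy.
Variables (R : realType).

Definition entropy (Z : finType) (p : Z -> R) : R := - \sum_z p z * ln (p z).

Lemma type_entropy_scale (Z : finType) (p : Z -> R) n (N : Z -> nat) :
  (0 < n)%N -> (forall z, (N z)%:R = n%:R * p z) -> type_entropy R n N = n%:R * entropy p.
Proof.
move=> n0 Np; rewrite /type_entropy /entropy mulrN mulr_sumr -sumrN; apply: eq_bigr => z _.
rewrite Np; have [->|p0] := eqVneq (p z) 0; first by rewrite !(mulr0, mul0r) oppr0.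
have pz : 0 < p z.
  rewrite lt_def p0 -(pmulr_rge0 _ (_ : 0 < n%:R)) ?ltr0n// -Np ler0n//.
by rewrite lnM ?posrE ?ltr0n//; lra.
Qed.

(** Gibbs inequality, from ln u <= u - 1 at u = n q(z) / N(z). *)
Lemma type_entropy_le_cross (Z : finType) (q : Z -> R) n (N : Z -> nat) :
  (\sum_z N z = n)%N -> (forall z, 0 < q z) -> \sum_z q z = 1 ->
  type_entropy R n N <= \sum_z (N z)%:R * - ln (q z).
Proof.
move=> sN q0 sq; rewrite -subr_le0 /type_entropy -sumrB.
apply: (@le_trans _ _ (\sum_z (n%:R * q z - (N z)%:R))); last first.
  by rewrite sumrB -mulr_sumr sq mulr1 -natr_sum sN subrr.
apply: ler_sum => z _; have [->|Nz] := posnP (N z).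
  by rewrite !mul0r subrr subr0 mulr_ge0// ltW.
have Nz0 : 0 < (N z)%:R :> R by rewrite ltr0n.
have n0 : 0 < n%:R :> R by rewrite ltr0n -sN (bigD1 z)//= ltn_addr.
have E : ln (1 + (n%:R * q z / (N z)%:R - 1)) <= n%:R * q z / (N z)%:R - 1.
  apply: le_ln1Dx; rewrite -subr_gt0 opprK subrK divr_gt0// mulr_gt0//.
move: E; rewrite addrC subrK ln_div ?posrE ?mulr_gt0// lnM ?posrE// => E.
have : (N z)%:R * (ln n%:R + ln (q z) - ln (N z)%:R) <=
       (N z)%:R * (n%:R * q z / (N z)%:R - 1) by rewrite ler_pM2l.
rewrite [in X in _ <= X]mulrBr mulrCA divff ?gt_eqF// !mulr1; lra.
Qed.

End Entropy.

(** * Expected number of labellings with prescribed vertex and edge types *)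

Section TypedPairs.
Variables (R : realType) (r : nat) (Y : finType).

Lemma card_hom n : (#|{: hom r n}| = n`! ^ r)%N.
Proof. by rewrite card_ffun card_ord card_Sn. Qed.

Definition typed_hom n (N0 : Y -> nat) (N : 'I_r -> Y * Y -> nat) (s : hom r n) :=
  [set y : {ffun 'I_n -> Y} | (y \in typed n N0) && [forall i, pairf y (s i) \in typed n (N i)]].

(** The generators are independent, and each one's success probability depends on [y] only through
    its type, so summing over [y] just multiplies by the size of the type class. *)
Lemma typed_hom_mean n (N0 : Y -> nat) (N : 'I_r -> Y * Y -> nat) :
  (\sum_a N0 a = n)%N ->
  (forall i a, \sum_b N i (a, b) = N0 a)%N -> (forall i b, \sum_a N i (a, b) = N0 b)%N ->
  (\sum_(s : hom r n) #|typed_hom N0 N s|)%:R / #|{: hom r n}|%:R =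
  #|typed n N0|%:R * \prod_i (#|typed n (N i)|%:R / #|typed n N0|%:R ^+ 2) :> R.
Proof.
move=> sN row col.
have -> : (\sum_(s : hom r n) #|typed_hom N0 N s| =
  \sum_(y in typed n N0) \prod_i #|[set s | pairf y s \in typed n (N i)]|)%N.
  rewrite (eq_bigr (fun s : hom r n => \sum_(y in typed n N0)
     \prod_i (pairf y (s i) \in typed n (N i)))%N); last first.
    move=> s _; rewrite -sum1_card big_mkcond [RHS]big_mkcond; apply: eq_bigr => y _.
    rewrite inE; case: (y \in _) => //=; case: forallP => H.
      by rewrite big1// => i _; rewrite H.
    apply/esym/eqP; rewrite -leqn0 leqNgt; apply/negP; rewrite lt0n => H1; apply: H => i.
    by apply: contraNT H1 => H1; rewrite (bigD1 i)//= (negPf H1).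
  rewrite exchange_big/=; apply: eq_bigr => y _.
  rewrite -(bigA_distr_bigA (fun i (s : 'S_n) => (pairf y s \in typed n (N i)) : nat))/=.
  by apply: eq_bigr => i _; rewrite -sum1dep_card [RHS]big_mkcond/=; apply: eq_bigr => s _; case: ifP.
rewrite natr_sum mulr_suml (eq_bigr (fun=> \prod_i (#|typed n (N i)|%:R / #|typed n N0|%:R ^+ 2) : R)).
  by rewrite sumr_const mulr_natl.
move=> y yN; rewrite natr_prod card_hom natrX -[X in _ / _ ^+ X](card_ord r) -prodr_const -prodf_div.
by apply: eq_bigr => i _; exact: perm_typed_prob.
Qed.

Lemma ln_prod (I : finType) (F : I -> R) : (forall i, 0 < F i) ->
  ln (\prod_i F i) = \sum_i ln (F i).
Proof.
move=> F0; suff [] : 0 < \prod_i F i /\ ln (\prod_i F i) = \sum_i ln (F i) by [].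
elim/big_rec2 : _ => [|i y1 y2 _ [y10 <-]]; first by rewrite ln1 ltr01.
by rewrite lnM ?posrE// mulr_gt0.
Qed.

(** The vertex labels contribute one [entropy p], and each generator contributes
    [entropy (q i) - 2 * entropy p]. Taking [n = D * m] keeps all the types integral. *)
Lemma typed_hom_rate (p : Y -> R) (q : 'I_r -> Y * Y -> R) (D : nat)
    (N0 : Y -> nat) (N : 'I_r -> Y * Y -> nat) (d : R) (n0 : nat) :
  (0 < D)%N -> \sum_a p a = 1 ->
  (forall i a, \sum_b q i (a, b) = p a) -> (forall i b, \sum_a q i (a, b) = p b) ->
  (forall a, (N0 a)%:R = D%:R * p a) -> (forall i a, (N i a)%:R = D%:R * q i a) ->
  0 < d ->
  exists m, [/\ (n0 <= D * m)%N, (0 < m)%N &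
    expR ((D * m)%:R * (\sum_i entropy (q i) - (2 * r%:R - 1) * entropy p - d)) <=
    (\sum_(s : hom r (D * m)) #|typed_hom (fun a => m * N0 a)%N (fun i a => m * N i a)%N s|)%:R
      / #|{: hom r (D * m)}|%:R].
Proof.
move=> D0 sp row col N0E NE d0.
have natE (a b : nat) : a%:R = b%:R :> R -> a = b by move=> /eqP; rewrite eqr_nat => /eqP.
have sN0 : (\sum_a N0 a = D)%N.
  apply: natE; rewrite natr_sum; under eq_bigr do rewrite N0E.
  by rewrite -mulr_sumr sp mulr1.
have rowN i a : (\sum_b N i (a, b) = N0 a)%N.
  apply: natE; rewrite natr_sum N0E -(row i); under eq_bigr do rewrite NE.
  by rewrite mulr_sumr.
have colN i b : (\sum_a N i (a, b) = N0 b)%N.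
  apply: natE; rewrite natr_sum N0E -(col i); under eq_bigr do rewrite NE.
  by rewrite mulr_sumr.
have sNi i : (\sum_a N i a = D)%N.
  rewrite -[RHS]sN0 -(eq_bigr _ (fun a _ => rowN i a)) pair_bigA/=.
  by apply: eq_bigr => -[].
(* Count of the logarithmic errors: [#|Y|] for the vertex type, and for each generator [#|Y * Y|]
   for its pair type and 2 for the squared denominator. *)
pose K : R := #|Y|%:R + r%:R * (#|{: Y * Y}|%:R + 2).
have K0 : 0 <= K by rewrite addr_ge0 ?mulr_ge0 ?addr_ge0 ?ler0n.
have [M HM] := @ln_natS_sublinear R (d / (K + 1)) (divr_gt0 d0 (ltr_wpDl K0 ltr01)).
exists (maxn (maxn M n0) 1); set m := maxn _ _; set n := (D * m)%N.
have m0 : (0 < m)%N by rewrite leq_max orbT.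
have mn : (m <= n)%N by rewrite leq_pmull.
have Mm : (maxn M n0 <= n)%N by rewrite (leq_trans _ mn)// leq_max leqnn.
have n_gt0 : (0 < n)%N by rewrite muln_gt0 D0.
split=> //; first by rewrite (leq_trans _ Mm)// leq_max leqnn orbT.
have sm (Z : finType) (f : Z -> nat) : (\sum_a f a = D -> \sum_a m * f a = n)%N.
  by rewrite -big_distrr/= => ->; rewrite mulnC.
rewrite typed_hom_mean; [|exact: sm| |]; last 2 first.
- by move=> i a; rewrite -big_distrr/= rowN.
- by move=> i a; rewrite -big_distrr/= colN.
have C0 (Z : finType) (f : Z -> nat) : (\sum_a f a = D)%N ->
    0 < #|typed n (fun a => m * f a)%N|%:R :> R.
  by move=> sf; rewrite ltr0n card_typed_gt0// sm.
rewrite -[leRHS]lnK; last first.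
  rewrite posrE mulr_gt0 ?C0// prodr_gt0// => i _.
  by rewrite divr_gt0 ?exprn_gt0 ?C0.
rewrite ler_expR lnM ?posrE ?C0 ?prodr_gt0//; last first.
  by move=> i _; rewrite divr_gt0 ?exprn_gt0 ?C0.
rewrite ln_prod; last by move=> i; rewrite divr_gt0 ?exprn_gt0 ?C0.
set L := ln n.+1%:R + 1 : R.
have HL : K * L <= n%:R * d.
  have L0 : 0 <= L by rewrite addr_ge0// ln_ge0// ler1n.
  have := HM n (leq_trans (leq_maxl _ _) Mm); rewrite -/L.
  by rewrite mulrAC ler_pdivlMr ?ltr_wpDl//; lra.
have tp : type_entropy R n (fun a => m * N0 a)%N = n%:R * entropy p.
  by apply: type_entropy_scale => // a; rewrite !natrM N0E; ring.
have tq i : type_entropy R n (fun a => m * N i a)%N = n%:R * entropy (q i).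
  by apply: type_entropy_scale => // a; rewrite !natrM NE; ring.
have l0 := ln_card_typed_ge R (sm _ _ sN0); have u0 := ln_card_typed_le R (sm _ _ sN0).
rewrite tp -/L in l0 u0.
have lq : \sum_i (n%:R * entropy (q i) - #|{: Y * Y}|%:R * L - 2 * (n%:R * entropy p + L)) <=
   \sum_i ln (#|typed n (fun a => m * N i a)%N|%:R / #|typed n (fun a => m * N0 a)%N|%:R ^+ 2 : R).
  apply: ler_sum => i _; rewrite ln_div ?posrE ?exprn_gt0 ?C0// lnXn ?C0//.
  have := ln_card_typed_ge R (sm _ _ (sNi i)); rewrite tq -/L.
  by move: u0; rewrite mulr2n; lra.
apply: le_trans (lerD l0 lq).
have sumc (c : R) : \sum_(i < r) c = r%:R * c by rewrite sumr_const card_ord mulr_natl.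
rewrite !sumrB !sumc -mulr_sumr.
move: HL; rewrite /K; set S := \sum_i _; set h := entropy p.
by move=> HL; rewrite mulrBr mulrBr; lra.
Qed.

End TypedPairs.

(** * Permutations whose pair frequencies are only approximately prescribed *)

Section NearTypes.
Variables (R : realType) (A : finType).

(** Min-entropy bounds entropy from below, so upper bounds on the frequencies are enough. *)
Lemma ln_card_typed_small (p : A -> nat) n (c : R) : (\sum_a p a = n)%N -> 0 < c ->
  (forall a, (p a)%:R <= n%:R * c) ->
  - n%:R * ln c - #|A|%:R * (ln n.+1%:R + 1) <= ln #|typed n p|%:R.
Proof.
move=> sp c0 pc; apply: le_trans (ln_card_typed_ge R sp); rewrite lerD2r /type_entropy.
have -> : - n%:R * ln c = \sum_a (p a)%:R * - ln c.
  by rewrite -mulr_suml -natr_sum sp mulrN mulNr.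
apply: ler_sum => a _; have [->|pa] := posnP (p a); first by rewrite !mul0r.
have pa0 : 0 < (p a)%:R :> R by rewrite ltr0n.
have n0 : 0 < n%:R :> R by rewrite ltr0n -sp (bigD1 a)//= ltn_addr.
rewrite ler_pM2l//; have : ln (p a)%:R <= ln (n%:R * c) by rewrite ler_ln ?posrE ?mulr_gt0.
by rewrite lnM ?posrE//; lra.
Qed.

Lemma cnt_pairf_row n (z : {ffun 'I_n -> A}) (s : 'S_n) a :
  (\sum_b cnt (pairf z s) (a, b) = cnt z a)%N.
Proof.
under eq_bigr do rewrite cntE; rewrite exchange_big/= cntE; apply: eq_bigr => v _.
rewrite ffunE (bigD1 (z (s v)))//= big1 => [|b bv]; rewrite xpair_eqE ?eqxx ?andbT ?addn0//.
by rewrite (eq_sym (z (s v))) (negPf bv) andbF.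
Qed.

Lemma cnt_pairf_col n (z : {ffun 'I_n -> A}) (s : 'S_n) b :
  (\sum_a cnt (pairf z s) (a, b) = cnt z b)%N.
Proof.
rewrite -(cnt_perm z s) cntE; under eq_bigr do rewrite cntE.
rewrite exchange_big/=; apply: eq_bigr => v _.
rewrite ffunE (bigD1 (z v))//= big1 => [|a av]; rewrite xpair_eqE ?eqxx ?addn0//.
by rewrite (eq_sym (z v)) (negPf av).
Qed.

(** Union bound over the polynomially many exact pair types. For each of them the numerator is
    bounded by cross entropy relative to [Q] and the denominator by min-entropy. *)
Lemma card_perm_near (Q : A * A -> R) (d c : R) n (z : {ffun 'I_n -> A}) :
  (0 < n)%N -> (forall e, 0 < Q e) -> \sum_e Q e = 1 -> 0 < c ->
  (forall a, (cnt z a)%:R <= n%:R * c) ->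
  #|[set s : 'S_n | [forall e, `|(cnt (pairf z s) e)%:R / n%:R - Q e| <= d]]|%:R / n`!%:R <=
  expR (n%:R * (\sum_e (Q e + d) * - ln (Q e) + 2 * ln c)
        + (#|{: A * A}|%:R + 1 + 2 * #|A|%:R) * (ln n.+1%:R + 1)).
Proof.
move=> n0 Q0 sQ c0 zc; set L := ln n.+1%:R + 1.
have nR : 0 < n%:R :> R by rewrite ltr0n.
(* The errors for one type: 1 from the pair type, [2 * #|A|] from the squared vertex type. The
   number of types accounts for the remaining [#|A * A|]. *)
set E := expR (n%:R * (\sum_e (Q e + d) * - ln (Q e) + 2 * ln c) + (1 + 2 * #|A|%:R) * L).
set P := [set s | _].
have sz : (\sum_a cnt z a = n)%N by rewrite sum_cnt card_ord.
have zt : z \in typed n (cnt z) by rewrite inE; apply/forallP.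
have szp s : (\sum_e cnt (pairf z s) e = n)%N by rewrite sum_cnt card_ord.
have one (N : A * A -> nat) : #|[set s in P | pairf z s \in typed n N]|%:R / n`!%:R <= E.
  (* Either [N] is not realized and contributes nothing, or a witness [s] shows that its marginals
     are the type of [z]. *)
  have [->|[s]] := finset.set_0Vmem [set s in P | pairf z s \in typed n N].
    by rewrite cards0 mul0r expR_ge0.
  rewrite !inE => /andP[/forallP sP /forallP sN].
  have {}sN e : N e = cnt (pairf z s) e by rewrite (eqP (sN e)).
  have H1 : #|[set s in P | pairf z s \in typed n N]|%:R / n`!%:R <=
            #|[set s | pairf z s \in typed n N]|%:R / n`!%:R :> R.
    rewrite ler_pM2r ?invr_gt0 ?ltr0n ?fact_gt0// ler_nat subset_leq_card//.
    by apply/fintype.subsetP => t; rewrite !inE => /andP[].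
  apply: (le_trans H1); rewrite (@perm_typed_prob _ _ R (cnt z)) //; last first.
  - by move=> b; under eq_bigr do rewrite sN; exact: cnt_pairf_col.
  - by move=> b; under eq_bigr do rewrite sN; exact: cnt_pairf_row.
  have sNn : (\sum_e N e = n)%N by rewrite -(szp s); apply: eq_bigr => e _.
  have CN : 0 < #|typed n N|%:R :> R by rewrite ltr0n card_typed_gt0.
  have Cz : 0 < #|typed n (cnt z)|%:R :> R by rewrite ltr0n card_typed_gt0.
  rewrite -[leLHS]lnK ?posrE ?divr_gt0 ?exprn_gt0// ler_expR.
  rewrite ln_div ?posrE ?exprn_gt0// lnXn//.
  have u1 := ln_card_typed_le R sNn; have u2 := type_entropy_le_cross sNn Q0 sQ.
  have l1 := ln_card_typed_small sz c0 zc; rewrite -/L in u1 l1.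
  have u3 : \sum_e (N e)%:R * - ln (Q e) <= n%:R * \sum_e (Q e + d) * - ln (Q e).
    rewrite mulr_sumr; apply: ler_sum => e _; rewrite mulrA ler_wpM2r//.
      rewrite oppr_ge0 ln_le0// -sQ (bigD1 e)//= lerDl sumr_ge0// => ? _; exact: ltW.
    have := sP e; rewrite -sN ler_distl => /andP[_].
    by rewrite ler_pdivrMr// mulrC.
  by move: u1 u2 u3 l1; rewrite mulr2n; lra.
have -> : #|P|%:R = \sum_(N : {ffun A * A -> 'I_n.+1})
    #|[set s in P | pairf z s \in typed n (fun e => N e : nat)]|%:R :> R.
  rewrite -natr_sum; congr _%:R.
  rewrite -sum1_card (partition_big (fun s : 'S_n => [ffun e => inord (cnt (pairf z s) e) : 'I_n.+1]) xpredT)//=.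
  apply: eq_bigr => N _; rewrite sum1dep_card; apply: eq_card => s; rewrite !inE; congr andb.
  have cn e : (cnt (pairf z s) e < n.+1)%N.
    by rewrite ltnS -[leqRHS](szp s) (bigD1 e)//= leq_addr.
  apply/eqP/forallP => [<- e|H]; first by rewrite ffunE inordK.
  by apply/ffunP => e; rewrite ffunE; apply: val_inj; rewrite /= inordK// (eqP (H e)).
rewrite mulr_suml; apply: (@le_trans _ _ (\sum_(N : {ffun A * A -> 'I_n.+1}) E)).
  by apply: ler_sum => N _; exact: one.
rewrite sumr_const card_ffun card_ord -[leLHS]mulr_natl natrX.
have -> : n.+1%:R ^+ #|{: A * A}| = expR (#|{: A * A}|%:R * ln n.+1%:R) :> R.
  by rewrite expRM_natl lnK// posrE ltr0n.
rewrite -expRD ler_expR /L.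
have := ler0n R #|{: A * A}|; lra.
Qed.

End NearTypes.

(** * Upper bound for the product joining *)

Section LimnEsup.
Variable R : realType.
Local Open Scope ereal_scope.

Lemma limn_esup_le_near (u : nat -> \bar R) M N :
  (forall n, (N <= n)%N -> u n <= M) -> limn_esup u <= M.
Proof.
move=> uM; rewrite /limn_esup limf_esupE.
apply: (@le_trans _ _ (ereal_sup [set u n | n in [set n | (N <= n)%N]])).
  apply: ereal_inf_lbound; exists [set n | (N <= n)%N]%classic => //.
  by exists N.
by apply: ge_ereal_sup => _ [n /= Nn <-]; exact: uM.
Qed.

Lemma limn_esup_ge_frequently (u : nat -> \bar R) M :
  (forall N, exists2 n, (N <= n)%N & M <= u n) -> M <= limn_esup u.
Proof.
move=> uM; rewrite /limn_esup limf_esupE.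
apply: le_ereal_inf_tmp => _ [V [N _ NV] <-]; have [n Nn un] := uM N.
by apply: (le_trans un); apply: ereal_sup_ubound; exists n => //; exact: NV.
Qed.

End LimnEsup.

Section SmallCylinders.
Variables (R : realType) (r : nat).

Definition FG1 : FG r := exist _ [::] isT.
Definition FGl (l : letter r) : FG r := exist _ [:: l] isT.

Section Emp.
Variables (A : finType) (n : nat) (s : hom r n) (x : {ffun 'I_n -> A}).

Lemma emp_vertex a : emp R s x [:: (FG1, a)] = (cnt x a)%:R / n%:R.
Proof.
by congr (_%:R / _); apply: eq_card => v; rewrite !inE /= andbT.
Qed.

Lemma emp_edge i a b :
  emp R s x [:: (FG1, a); (FGl (i, false), b)] = (cnt (pairf x (s i)) (a, b))%:R / n%:R.
Proof.
by congr (_%:R / _); apply: eq_card => v; rewrite !inE /= ffunE andbT xpair_eqE.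
Qed.
End Emp.

Variable eps : R.

Lemma trans_sum a : \sum_b trans eps a b = 1.
Proof. by rewrite big_bool /trans; case: a => /=; lra. Qed.

Lemma Ising_vertex a : Ising eps [:: (FG1, a)] = 2^-1.
Proof. by rewrite /Ising big_seq1 /= big_bool /agree/=; case: a; rewrite /=; lra. Qed.

Lemma Ising_edge l a b : Ising eps [:: (FG1, a); (FGl l, b)] = 2^-1 * trans eps a b.
Proof.
rewrite /Ising big_cons big_seq1 /=.
have agE (x : bool) : agree R [:: (FG1, a); (FGl l, b)] [::] x = (x == a)%:R.
  by rewrite /agree /= andbT eq_sym; case: eqP.
rewrite (bigD1 a)//= [X in _ + X]big1 ?addr0 => [|x xa]; last first.
  by rewrite agE (negPf xa) mul0r mulr0.
rewrite agE eqxx mul1r (bigD1 l)//= [X in _ * (_ * X)]big1 ?mulr1 => [|l' l'l].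
  rewrite (bigD1 b)//= [X in _ + X]big1 ?addr0 => [|b' b'b].
    by rewrite /agree /= !eqxx !mulr1.
  by rewrite /agree /= !eqxx /= (eq_sym b) (negPf b'b) mul0r mulr0.
rewrite -[RHS](trans_sum a); apply: eq_bigr => c _.
rewrite /agree /= (_ : ([:: l] == [:: l']) = false) ?mulr1//.
by apply/eqP => -[E]; rewrite E eqxx in l'l.
Qed.

End SmallCylinders.
Arguments FG1 {r}.

Section EdgeCyls.
Variables (r : nat) (A : finType).

(** The statistics used both for the upper bound on the product joining and for reading off the cut
    of a colouring; inverse generators give the same edges. *)
Definition edge_cyls : seq (cyl r A) :=
  [seq [:: (FG1, a)] | a <- enum A] ++
  [seq [:: (FG1, p.2.1); (FGl (p.1, false), p.2.2)] | p <- enum {: 'I_r * (A * A)}].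

Lemma edge_cyls_vertex a : [:: (FG1, a)] \in edge_cyls.
Proof. by rewrite mem_cat map_f ?mem_enum. Qed.

Lemma edge_cyls_edge i a b : [:: (FG1, a); (FGl (i, false), b)] \in edge_cyls.
Proof.
rewrite mem_cat; apply/orP; right.
by apply/mapP; exists (i, (a, b)); rewrite ?mem_enum.
Qed.

End EdgeCyls.
Arguments edge_cyls : clear implicits.

Section ProductUpperBound.
Variables (R : realType) (r : nat) (eps : R).
Hypotheses (eps0 : 0 < eps) (eps1 : eps < 1).

Definition binent (e : R) : R := - ((1 - e) * ln (1 - e) + e * ln e).
(** This is r times the edge entropy ln 2 + h minus (2r - 1) times the vertex entropy ln 2. *)
Definition f_Ising (e : R) : R := (1 - r%:R) * ln 2 + r%:R * binent e.

Definition edge_pair (e : (bool * bool) * (bool * bool)) : R :=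
  4^-1 * (trans eps e.1.1 e.2.1 * trans eps e.1.2 e.2.2).

Lemma trans_gt0 a b : 0 < trans eps a b.
Proof. by rewrite /trans; case: eqP => _; rewrite ?subr_gt0. Qed.

Lemma edge_pair_gt0 e : 0 < edge_pair e.
Proof. by rewrite /edge_pair !mulr_gt0 ?trans_gt0. Qed.

Lemma edge_pair_sum : \sum_e edge_pair e = 1.
Proof.
rewrite -(pair_bigA _ (fun a b => edge_pair (a, b)))/=.
rewrite -(pair_bigA _ (fun a a' => \sum_b edge_pair ((a, a'), b)))/=.
do ?[rewrite !big_bool/=]; rewrite -!(pair_bigA _ (fun b b' => edge_pair ((_, _), (b, b'))))/=.
rewrite !big_bool /edge_pair /trans /=; lra.
Qed.

Lemma edge_pair_entropy : \sum_e edge_pair e * - ln (edge_pair e) = ln 4 + 2 * binent eps.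
Proof.
have lnE e : ln (edge_pair e) = - ln 4 + ln (trans eps e.1.1 e.2.1) + ln (trans eps e.1.2 e.2.2).
  by rewrite /edge_pair !lnM ?posrE ?mulr_gt0 ?trans_gt0// lnV ?posrE// addrA.
under eq_bigr do rewrite lnE.
rewrite -(pair_bigA _ (fun a b => edge_pair (a, b) * - (- ln 4 + ln (trans eps a.1 b.1) + ln (trans eps a.2 b.2))))/=.
rewrite -(pair_bigA _ (fun a a' => \sum_b edge_pair ((a, a'), b) *
  - (- ln 4 + ln (trans eps a b.1) + ln (trans eps a' b.2))))/=.
rewrite !big_bool/= -!(pair_bigA _ (fun b b' => edge_pair ((_, _), (b, b')) *
  - (- ln 4 + ln (trans eps _ b) + ln (trans eps _ b'))))/=.
rewrite !big_bool /edge_pair /trans /= /binent; lra.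
Qed.

Let mu : cyl r (bool * bool)%type -> R := prod_meas (@Ising R r eps) (@Ising R r eps).

Lemma mu_vertex a : mu [:: (FG1, a)] = 4^-1.
Proof. by rewrite /mu /prod_meas /= !Ising_vertex; lra. Qed.

Lemma mu_edge l a b : mu [:: (FG1, a); (FGl l, b)] = edge_pair (a, b).
Proof. by rewrite /mu /prod_meas /= !Ising_edge /edge_pair; lra. Qed.

Lemma in_nbhd_edges n (s : hom r n) (x : {ffun 'I_n -> bool * bool}) d :
  (0 < n)%N -> in_nbhd mu (edge_cyls r (bool * bool)%type) d s x ->
  (forall a, (cnt x a)%:R <= n%:R * (4^-1 + d)) /\
  (forall i, [forall e, `|(cnt (pairf x (s i)) e)%:R / n%:R - edge_pair e| <= d]).
Proof.
move=> n0 /allP H; have nR : 0 < n%:R :> R by rewrite ltr0n.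
split=> [a|i].
  have := H _ (edge_cyls_vertex r a); rewrite emp_vertex mu_vertex ltr_distl => /andP[_].
  by rewrite ltr_pdivrMr// mulrC; exact: ltW.
apply/forallP => -[a b]; have := H _ (edge_cyls_edge i a b).
by rewrite emp_edge mu_edge; exact: ltW.
Qed.

Lemma expOmega_prod_le n d : (0 < n)%N -> 0 < d ->
  expOmega mu (edge_cyls r (bool * bool)%type) d n <=
  expR (n%:R * (ln 4 + r%:R * (\sum_e (edge_pair e + d) * - ln (edge_pair e) + 2 * ln (4^-1 + d)))
        + r%:R * (25 * (ln n.+1%:R + 1))).
Proof.
move=> n0 d0; rewrite /expOmega.
pose c : R := 4^-1 + d; have c0 : 0 < c by rewrite addr_gt0 ?invr_gt0.
pose good := [set x : {ffun 'I_n -> bool * bool} | `[< forall a, (cnt x a)%:R <= n%:R * c >]].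
pose near (x : {ffun 'I_n -> bool * bool}) :=
  [set s : 'S_n | [forall e, `|(cnt (pairf x s) e)%:R / n%:R - edge_pair e| <= d]].
have le1 : (\sum_(s : hom r n) #|[set x | in_nbhd mu (edge_cyls r (bool * bool)%type) d s x]| <=
    \sum_(x in good) \prod_(i < r) #|near x|)%N.
  apply: (@leq_trans (\sum_(s : hom r n) \sum_(x in good) \prod_i (s i \in near x))%N).
    apply: leq_sum => s _; rewrite -sum1_card big_mkcond [leqRHS]big_mkcond; apply: leq_sum => x _.
    rewrite inE; case: ifP => // /(in_nbhd_edges n0)[xg xn].
    rewrite inE (asboolT xg) big1// => i _; by rewrite inE xn.
  rewrite exchange_big/=; apply: leq_sum => x _.
  rewrite -(bigA_distr_bigA (fun (i : 'I_r) (s : 'S_n) => (s \in near x) : nat))/=.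
  by apply: leq_prod => i _; rewrite -sum1_card [leqRHS]big_mkcond/= leq_sum// => s _; case: ifP.
apply: (@le_trans _ _ ((\sum_(x in good) \prod_(i < r) #|near x|)%:R / #|{: hom r n}|%:R)).
  by rewrite ler_wpM2r ?invr_ge0 ?ler0n// ler_nat.
set W := \sum_e _; set B := expR (n%:R * (W + 2 * ln c) +
  (#|{: (bool * bool) * (bool * bool)}|%:R + 1 + 2 * #|{: bool * bool}|%:R) * (ln n.+1%:R + 1)).
rewrite natr_sum mulr_suml.
apply: (@le_trans _ _ (\sum_(x in good) B ^+ r)).
  apply: ler_sum => x; rewrite inE => /asboolP xg.
  rewrite prod_nat_const card_ord natrX card_hom natrX -expr_div_n.
  rewrite lerXn2r ?nnegrE ?divr_ge0 ?expR_ge0 ?ler0n//.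
  exact: card_perm_near n0 edge_pair_gt0 edge_pair_sum c0 xg.
rewrite sumr_const -[leLHS]mulr_natl.
apply: (@le_trans _ _ ((4 ^ n)%:R * B ^+ r)).
  rewrite ler_wpM2r ?exprn_ge0 ?expR_ge0// ler_nat.
  by rewrite (leq_trans (max_card _))// card_ffun card_prod card_bool card_ord.
have -> : (4 ^ n)%:R = expR (n%:R * ln 4) :> R by rewrite expRM_natl lnK ?posrE// natrX.
rewrite /B -expRM_natl -expRD ler_expR !card_prod card_bool.
have -> : (2 * 2 * (2 * 2))%:R + 1 + 2 * (2 * 2)%:R = 25 :> R by rewrite !natrM; lra.
by rewrite le_eqVlt; apply/orP; left; apply/eqP; rewrite /c; ring.
Qed.

Lemma f_inv_prod_le : (f_inv mu <= (2 * f_Ising eps)%:E)%E.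
Proof.
apply/lee_addgt0Pr => d d0; rewrite -EFinD.
pose K1 := \sum_e - ln (edge_pair e).
have K10 : 0 <= K1.
  apply: sumr_ge0 => e _; rewrite oppr_ge0 ln_le0// -edge_pair_sum (bigD1 e)//= lerDl.
  by rewrite sumr_ge0// => ? _; exact/ltW/edge_pair_gt0.
(* The radius [d'] costs [K1] through the cross entropy and 8 through [2 * ln (4^-1 + d')], per
   generator; adding 1 makes [K2] positive. *)
pose K2 := r%:R * (K1 + 8) + 1.
have K20 : 0 < K2 by rewrite ltr_wpDl// mulr_ge0 ?ler0n// addr_ge0.
pose d' := d / 2 / K2; have d'0 : 0 < d' by rewrite !divr_gt0.
have r250 : 0 < r%:R * 25 + 1 :> R by rewrite ltr_wpDl// mulr_ge0 ?ler0n.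
have [N HN] := @ln_natS_sublinear R (d / 2 / (r%:R * 25 + 1)) (divr_gt0 (divr_gt0 d0 (ltr0Sn _ 1)) r250).
apply: (@le_trans _ _ (limn_esup (rate mu (edge_cyls r (bool * bool)%type) d'))).
  by apply: ereal_inf_lbound; exists (edge_cyls r (bool * bool)%type) => //; exists d'.
apply: (@limn_esup_le_near _ _ _ N.+1) => n Nn.
have n0 : (0 < n)%N by exact: leq_ltn_trans Nn.
have nR : 0 < n%:R :> R by rewrite ltr0n.
rewrite /rate; case: ifPn => [_|E0]; first by rewrite leNye.
rewrite lee_fin ler_pdivrMr//.
have Epos : 0 < expOmega mu (edge_cyls r (bool * bool)%type) d' n.
  by rewrite lt_def E0 /expOmega divr_ge0 ?ler0n.
have := expOmega_prod_le n0 d'0; rewrite -{1}[expOmega _ _ _ _]lnK ?posrE// ler_expR => H.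
apply: (le_trans H); set L := ln n.+1%:R + 1.
have HL : r%:R * (25 * L) <= d / 2 * n%:R.
  have L0 : 0 <= L by rewrite addr_ge0// ln_ge0// ler1n.
  by have := HN n (ltnW Nn); rewrite -/L mulrAC ler_pdivlMr//; lra.
have Hln : ln (4^-1 + d') <= - ln 4 + 4 * d'.
  have -> : 4^-1 + d' = 4^-1 * (1 + 4 * d') by rewrite mulrDr mulr1 mulrA mulVf ?mul1r// pnatr_eq0.
  have d4 : 0 < 4 * d' by rewrite mulr_gt0.
  have d41 : 0 < 1 + 4 * d' by rewrite addr_gt0.
  rewrite lnM ?posrE ?invr_gt0// lnV ?posrE// lerD2l le_ln1Dx//.
  by rewrite (lt_trans _ d4) ?ltrN10.
have HW : \sum_e (edge_pair e + d') * - ln (edge_pair e) = ln 4 + 2 * binent eps + d' * K1.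
  by rewrite -edge_pair_entropy mulr_sumr -big_split/=; apply: eq_bigr => e _; rewrite mulrDl.
have Hd : d' * K2 = d / 2 by rewrite /d' divfK// gt_eqF.
have ln4 : ln 4 = 2 * ln 2 :> R.
  by rewrite (_ : 4 = 2 * 2 :> R) ?lnM ?posrE//; lra.
rewrite HW /f_Ising ln4 in Hln *.
have : n%:R * (2 * ln 2 + r%:R * (2 * ln 2 + 2 * binent eps + d' * K1 + 2 * ln (4^-1 + d'))) <=
  n%:R * (2 * ln 2 + r%:R * (2 * ln 2 + 2 * binent eps + d' * K1 + 2 * (- (2 * ln 2) + 4 * d'))).
  by rewrite ler_pM2l// lerD2l ler_wpM2l ?ler0n// lerD2l ler_pM2l.
have : n%:R * (d' * K2) = n%:R * (d / 2) by rewrite Hd.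
have : 0 <= n%:R * d' by rewrite mulr_ge0 ?ler0n// ltW.
by rewrite /K2; lra.
Qed.

End ProductUpperBound.

(** * Concentration of the minimum bisection *)

Section Concentration.
Variable R : realType.

Lemma expR_le_quad (x : R) : `|x| <= 4^-1 -> expR x <= 1 + x + x ^+ 2.
Proof.
rewrite ler_norml => /andP[xl xu].
have inv (y : R) : y < 1 -> expR y * (1 - y) <= 1.
  move=> y1; rewrite -[leRHS](@expRxMexpNx_1 R y) ler_pM2l ?expR_gt0//.
  exact: expR_ge1Dx.
have [x0|x0] := leP x 0.
  by have := inv x; have := expR_gt0 x; nra.
(* For positive x the bound 1/(1 - x) exceeds 1 + x + x^2, so it is applied at x/2 and squared. *)
have : expR x * (1 - x / 2) ^+ 2 <= 1.
  rewrite [in expR x](splitr x) expRD expr2 mulrACA.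
  have h := inv (x / 2); have h0 := expR_gt0 (x / 2).
  by rewrite mulr_ile1 ?mulr_ge0 ?h//; lra.
have : 0 < (1 - x / 2) ^+ 2 by rewrite exprn_gt0//; lra.
move=> p0 p1; rewrite -(ler_pM2r p0); apply: (le_trans p1); nra.
Qed.

(** A crude Hoeffding lemma: after centring at the average, the linear terms of the quadratic bound
    sum to zero. *)
Lemma avg_expR_le (I : finType) (J : {set I}) (x : I -> R) (B : R) :
  (forall i j, i \in J -> j \in J -> `|x i - x j| <= B) -> B <= 4^-1 ->
  (\sum_(i in J) expR (x i)) / #|J|%:R <= expR ((\sum_(i in J) x i) / #|J|%:R + B ^+ 2).
Proof.
move=> xB B4; have [->|[i0 i0J]] := finset.set_0Vmem J; first by rewrite cards0 invr0 mulr0 expR_ge0.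
have J0 : 0 < #|J|%:R :> R by rewrite ltr0n; apply/card_gt0P; exists i0.
set m := (\sum_(i in J) x i) / _.
have sm : \sum_(i in J) x i = #|J|%:R * m by rewrite /m mulrC divfK ?gt_eqF.
have B0 : 0 <= B by apply: le_trans (xB i0 i0 i0J i0J).
have dm i : i \in J -> `|x i - m| <= B.
  move=> iJ; rewrite -(ler_pM2l J0) -[in X in X * _](ger0_norm (ltW J0)) -normrM mulrBr -sm.
  have -> : #|J|%:R * x i - \sum_(j in J) x j = \sum_(j in J) (x i - x j).
    by rewrite sumrB sumr_const mulr_natl.
  apply: (le_trans (ler_norm_sum _ _ _)).
  rewrite mulr_natl -sumr_const; apply: ler_sum => j jJ; exact: xB.
rewrite ler_pdivrMr// expRD.
apply: (@le_trans _ _ (\sum_(i in J) expR m * (1 + (x i - m) + B ^+ 2))).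
  apply: ler_sum => i iJ; rewrite -{1}(subrK m (x i)) addrC expRD ler_pM2l ?expR_gt0//.
  apply: (le_trans (expR_le_quad (le_trans (dm i iJ) B4))).
  by rewrite lerD2l -real_normK ?num_real// lerXn2r ?nnegrE// dm.
rewrite -mulr_sumr -mulrA ler_pM2l ?expR_gt0// !big_split/= sumrN sm !sumr_const.
rewrite -(mulr_natl m) -(mulr_natl (B ^+ 2)) mulrC; have := expR_ge1Dx (B ^+ 2); nra.
Qed.

Section Hom.
Variables (r n : nat).
Implicit Types (s : hom r n) (i : 'I_r) (u : 'S_n) (f g : hom r n -> R).

Definition lmulh i u s : hom r n := [ffun j => if j == i then (u * s j)%g else s j].
Definition rmulh i u s : hom r n := [ffun j => if j == i then (s j * u)%g else s j].

Lemma lmulhM i u u' s : lmulh i u (lmulh i u' s) = lmulh i (u * u')%g s.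
Proof. by apply/ffunP => j; rewrite !ffunE; case: eqP => //; rewrite mulgA. Qed.

Lemma lmulh1 i s : lmulh i 1%g s = s.
Proof. by apply/ffunP => j; rewrite !ffunE; case: eqP => //; rewrite mul1g. Qed.

Lemma lmulh_inj i u : injective (lmulh i u).
Proof.
apply: (can_inj (g := lmulh i u^-1%g)) => s.
by rewrite lmulhM mulVg lmulh1.
Qed.

Lemma lmulh_comm i i' u u' s : i != i' -> lmulh i u (lmulh i' u' s) = lmulh i' u' (lmulh i u s).
Proof.
move=> ii'; apply/ffunP => j; rewrite !ffunE.
by have [->|//] := eqVneq j i; rewrite (negPf ii').
Qed.

Lemma lrmulh i i' u u' s : lmulh i u (rmulh i' u' s) = rmulh i' u' (lmulh i u s).
Proof. by apply/ffunP => j; rewrite !ffunE; do 2?case: ifP; rewrite // mulgA. Qed.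

Definition mean f : R := (\sum_s f s) / #|{: hom r n}|%:R.

Lemma card_hom_gt0 : 0 < #|{: hom r n}|%:R :> R.
Proof. by rewrite ltr0n; apply/card_gt0P; exists [ffun=> 1%g]. Qed.

Lemma mean_const c : mean (fun=> c) = c.
Proof.
by rewrite /mean sumr_const -[_ *+ _]mulr_natl mulrAC divff ?mul1r// gt_eqF ?card_hom_gt0.
Qed.

Lemma ler_mean f g : (forall s, f s <= g s) -> mean f <= mean g.
Proof.
by move=> fg; rewrite ler_wpM2r ?invr_ge0 ?ler0n//; apply: ler_sum.
Qed.

Lemma meanZ c f : mean (fun s => c * f s) = c * mean f.
Proof. by rewrite /mean -mulr_sumr mulrA. Qed.

Definition upto (k : 'I_n) := [set j : 'I_n | (j <= k)%N].

Lemma card_upto_gt0 k : 0 < #|upto k|%:R :> R.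
Proof. by rewrite ltr0n; apply/card_gt0P; exists k; rewrite inE. Qed.

(* One step of the Fisher-Yates shuffle. *)
Definition step i k f s : R := (\sum_(j in upto k) f (lmulh i (tperm k j) s)) / #|upto k|%:R.

Lemma mean_step i k f : mean (step i k f) = mean f.
Proof.
rewrite /mean /step -mulr_suml exchange_big/=.
have E j : \sum_s f (lmulh i (tperm k j) s) = \sum_s f s.
  by rewrite [RHS](reindex_inj (@lmulh_inj i (tperm k j))).
under eq_bigr do rewrite E.
rewrite sumr_const -[_ *+ _]mulr_natl; congr (_ / _).
by rewrite mulrAC divff ?mul1r// gt_eqF ?card_upto_gt0.
Qed.

(** Lipschitz under transpositions on the right, while the shuffle multiplies on the left: the two
    commute, so averaging keeps the constant. *)
Definition lip c f := forall s i a b, `|f (rmulh i (tperm a b) s) - f s| <= c.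

Lemma lip_step c i k f : lip c f -> lip c (step i k f).
Proof.
move=> fc s i' a b; rewrite /step -mulrBl -sumrB normrM normfV (ger0_norm (ler0n _ _)).
rewrite ler_pdivrMr ?card_upto_gt0//; apply: (le_trans (ler_norm_sum _ _ _)).
rewrite mulr_natr -sumr_const; apply: ler_sum => j _.
by rewrite lrmulh; exact: fc.
Qed.

Lemma lip_lmulh c f i a b s : lip c f -> `|f (lmulh i (tperm a b) s) - f s| <= c.
Proof.
move=> fc; have -> : lmulh i (tperm a b) s = rmulh i (tperm (s i a) (s i b)) s.
  apply/ffunP => j; rewrite !ffunE; case: eqP => // ->.
  by rewrite -tpermJ /conjg !mulgA mulgV mul1g.
exact: fc.
Qed.

(** Every averaged value lies within [c] of [f s], hence any two within [2 * c], which is the range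
    fed to [avg_expR_le]. *)
Lemma mean_expR_step c t i k f : lip c f -> 2 * (`|t| * c) <= 4^-1 ->
  mean (fun s => expR (t * f s)) <=
  expR ((2 * (`|t| * c)) ^+ 2) * mean (fun s => expR (t * step i k f s)).
Proof.
move=> fc tc; rewrite -(mean_step i k) -meanZ; apply: ler_mean => s.
have -> : t * step i k f s = (\sum_(j in upto k) t * f (lmulh i (tperm k j) s)) / #|upto k|%:R.
  by rewrite /step mulrA mulr_sumr.
rewrite -expRD addrC.
apply: avg_expR_le tc => j j' _ _; rewrite -mulrBr normrM mulrCA.
rewrite ler_wpM2l// (le_trans (ler_distD (f s) _ _))//.
by rewrite mulr_natl mulr2n lerD//; last rewrite distrC; exact: lip_lmulh.
Qed.

Definition stepi i f := foldl (fun g k => step i k g) f (enum 'I_n).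
Definition shuffle f := foldl (fun g i => stepi i g) f (enum 'I_r).

Lemma foldl_step_ind (P : (hom r n -> R) -> (hom r n -> R) -> Prop) :
  (forall f, P f f) -> (forall f g i k, P f g -> P f (step i k g)) ->
  forall f, P f (shuffle f).
Proof.
move=> P0 PS f; have Pi i g l : P f g -> P f (foldl (fun g k => step i k g) g l).
  by elim: l g => //= k l IH g Pg; apply: IH; exact: PS.
suff Ph l g : P f g -> P f (foldl (fun g i => stepi i g) g l) by exact: Ph.
by elim: l g => //= i l IH g Pg; apply: IH; exact: Pi.
Qed.

Lemma mean_shuffle f : mean (shuffle f) = mean f.
Proof.
apply: (foldl_step_ind (P := fun f g => mean g = mean f)) => // {}f g i k <-.
exact: mean_step.
Qed.

Lemma mean_expR_shuffle c t f : lip c f -> 2 * (`|t| * c) <= 4^-1 ->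
  mean (fun s => expR (t * f s)) <=
  expR ((r * n)%:R * (2 * (`|t| * c)) ^+ 2) * mean (fun s => expR (t * shuffle f s)).
Proof.
move=> fc tc; set B := _ ^+ 2.
have one i g : lip c g -> lip c (stepi i g) /\
    mean (fun s => expR (t * g s)) <= expR (n%:R * B) * mean (fun s => expR (t * stepi i g s)).
  move=> gc; rewrite /stepi -[in n%:R](size_enum_ord n).
  elim/last_ind: (enum 'I_n) => [|l k [lc IH]]; first by rewrite mul0r expR0 mul1r.
  rewrite foldl_rcons size_rcons; split; first exact: lip_step.
  apply: (le_trans IH); rewrite -natr1 mulrDl mul1r expRD -mulrA ler_pM2l ?expR_gt0//.
  exact: mean_expR_step.
suff [] : lip c (shuffle f) /\ mean (fun s => expR (t * f s)) <=
  expR ((r * n)%:R * B) * mean (fun s => expR (t * shuffle f s)) by [].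
rewrite /shuffle -[in (r * n)%:R](size_enum_ord r).
elim/last_ind: (enum 'I_r) => [|l i [lc IH]]; first by rewrite mul0r expR0 mul1r.
rewrite foldl_rcons size_rcons; have [sc H] := one i _ lc; split=> //.
apply: (le_trans IH); rewrite mulSn addnC natrD mulrDl expRD -mulrA ler_pM2l ?expR_gt0//.
Qed.

(** Progress measure of the shuffle: invariance under the copy of Sym(k) in coordinate [i], from the
    trivial group at 0 to all of Sym(n) at [n]. *)
Definition inv_upto i (k : nat) f :=
  forall u, (forall v : 'I_n, (k <= v)%N -> u v = v) -> forall s, f (lmulh i u s) = f s.

Lemma inv_upto0 i f : inv_upto i 0 f.
Proof.
move=> u u1 s; have -> : u = 1%g by apply/permP => v; rewrite perm1 u1.
by rewrite lmulh1.
Qed.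

(** Coset decomposition of Sym(k+1) over Sym(k): [tperm k j * u * tperm k (u j)] fixes [k] and
    everything above it, so multiplying by [u] only permutes the terms of the average. *)
Lemma inv_upto_step i (k : 'I_n) f : inv_upto i k f -> inv_upto i k.+1 (step i k f).
Proof.
move=> fk u uk s; rewrite /step; congr (_ / _).
have uup j : (u j \in upto k) = (j \in upto k).
  rewrite !inE; have [jk|jk] := ltnP k j; first by rewrite uk// leqNgt jk.
  rewrite leqNgt; apply/negP => kj; move: (kj); have := uk _ kj.
  by move=> /perm_inj ->; rewrite ltnNge jk.
rewrite [RHS](reindex_inj (@perm_inj _ u))/= (eq_bigl (mem (upto k)) _ uup).
apply: eq_bigr => j jk.
have -> : lmulh i (tperm k j) (lmulh i u s) =
    lmulh i (tperm k j * u * tperm k (u j))%g (lmulh i (tperm k (u j)) s).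
  by rewrite !lmulhM -!mulgA tperm2 mulg1.
apply: fk => v; rewrite leq_eqVlt => /orP[/eqP/val_inj <-|kv].
  by rewrite !permM tpermL tpermR.
have jv : j != v.
  by apply: contraTneq jk => ->; rewrite inE -ltnNge.
have ujv : u j != v.
  by rewrite -[X in _ != X](uk v kv) (inj_eq perm_inj).
have kv' : k != v by apply: contraTneq kv => ->; rewrite ltnn.
by rewrite !permM (tpermD kv' jv) (uk v kv) tpermD.
Qed.

Lemma inv_upto_step_neq i i' k k' f : i != i' -> inv_upto i k f -> inv_upto i k (step i' k' f).
Proof.
move=> ii' fk u uk s; rewrite /step; congr (_ / _); apply: eq_bigr => j _.
by rewrite lmulh_comm 1?eq_sym// fk.
Qed.

Lemma inv_stepi i f : inv_upto i n (stepi i f).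
Proof.
(* Generalized to initial segments of the enumeration, since the steps must run through [k] in
   increasing order. *)
rewrite /stepi; suff H l : map val l = iota 0 (size l) ->
    inv_upto i (size l) (foldl (fun g (k : 'I_n) => step i k g) f l).
  by have := H (enum 'I_n); rewrite size_enum_ord val_enum_ord; apply.
elim/last_ind: l => [_|l k IH]; first exact: inv_upto0.
rewrite size_rcons map_rcons -addn1 iotaD cats1 add0n => /rcons_inj[/IH H kE].
by rewrite foldl_rcons -kE addn1; apply: inv_upto_step; rewrite kE.
Qed.

Lemma inv_stepi_neq i i' k f : i != i' -> inv_upto i k f -> inv_upto i k (stepi i' f).
Proof.
move=> ii' fk; rewrite /stepi; elim/last_ind: (enum 'I_n) => [|l k' IH]//.
by rewrite foldl_rcons; exact: inv_upto_step_neq.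
Qed.

Lemma inv_shuffle i f : inv_upto i n (shuffle f).
Proof.
rewrite /shuffle; have := mem_enum 'I_r i.
elim/last_ind: (enum 'I_r) => [//|l j IH]; rewrite mem_rcons inE foldl_rcons.
have [->|ij] := eqVneq i j; first by move=> _; exact: inv_stepi.
by move=> /= /IH; exact: inv_stepi_neq.
Qed.

(** Invariance in every coordinate lets [s] be replaced by any [s'] one generator at a time, so the
    shuffled function is constant; its value is the mean. *)
Lemma shuffleE f s : shuffle f s = mean f.
Proof.
rewrite -mean_shuffle -[LHS]mean_const /mean; congr (_ / _); apply: eq_bigr => s' _.
pose h l := foldr (fun i s0 => lmulh i (s' i * (s0 i)^-1)%g s0) s l.
have hE l : shuffle f (h l) = shuffle f s.
  elim: l => [|i l IH]//=; rewrite -IH; apply: (@inv_shuffle i).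
  by move=> v; rewrite leqNgt ltn_ord.
rewrite -(hE (enum 'I_r)); congr (shuffle f).
suff H l j : h l j = if j \in l then s' j else s j.
  by apply/ffunP => j; rewrite H mem_enum.
elim: l => [|i l IH]//=; rewrite ffunE inE; case: eqP => [->|_]/=; last exact: IH.
by rewrite -mulgA mulVg mulg1.
Qed.

(** An Azuma-type bound: [r * n] shuffle steps lead from [f] to its mean, each costing one
    factor. *)
Lemma mean_expR_le c t f : lip c f -> 2 * (`|t| * c) <= 4^-1 ->
  mean (fun s => expR (t * f s)) <= expR ((r * n)%:R * (2 * (`|t| * c)) ^+ 2 + t * mean f).
Proof.
move=> fc tc; apply: (le_trans (mean_expR_shuffle fc tc)).
rewrite expRD ler_pM2l ?expR_gt0//.
have -> : mean (fun s => expR (t * shuffle f s)) = mean (fun=> expR (t * mean f)).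
  by rewrite /mean; congr (_ / _); apply: eq_bigr => s _; rewrite shuffleE.
by rewrite mean_const.
Qed.

End Hom.
End Concentration.

(** * Exponential lower tail of the minimum bisection *)

Section McutTail.
Variables (R : realType) (r : nat).

(** Only the two [i]-edges that end at [a] and [b] change; [Z] collects their sources. *)
Lemma cut_size_rmulh n (s : hom r n) i a b (V : {set 'I_n}) :
  (cut_size (rmulh i (tperm a b) s) V <= cut_size s V + 2)%N.
Proof.
set s' := rmulh _ _ _; rewrite /cut_size.
set X' := [set p | _]; set X := [set p | _ != (s _ _ \in V)].
pose Z := [set ((s i)^-1 a, i)%g; ((s i)^-1 b, i)%g].
apply: (@leq_trans #|X :|: Z|).
  apply/subset_leq_card/fintype.subsetP => -[v j]; rewrite !inE/= ffunE.
  have [->|_] := eqVneq j i; last by move=> ->.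
  rewrite permM; have [E|na] := eqVneq a (s i v); first by rewrite E permK eqxx !orbT.
  have [E|nb] := eqVneq b (s i v); first by rewrite E permK eqxx !orbT.
  by rewrite tpermD// => ->.
apply: (leq_trans (leq_card_setU _ _)).
by rewrite leq_add2l cards2; case: eqP.
Qed.

Lemma mcut_rmulh n (s : hom r n) i a b : (mcut (rmulh i (tperm a b) s) <= mcut s + 2)%N.
Proof.
rewrite /mcut; apply: (big_ind2 (fun x y => (x <= y + 2)%N)) => [|x1 x2 y1 y2 H1 H2|V _].
- exact: leq_addr.
- by rewrite addn_minl leq_min !geq_min H1 H2 orbT.
- exact: cut_size_rmulh.
Qed.

Lemma lip_mcut n : @lip R r n 2 (fun s => (mcut s)%:R).
Proof.
move=> s i a b; rewrite ler_distl -natrD !ler_nat mcut_rmulh andbT.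
rewrite lerBlDr -natrD ler_nat.
have {1}-> : s = rmulh i (tperm a b) (rmulh i (tperm a b) s).
  by apply/ffunP => j; rewrite !ffunE; case: eqP => // _; rewrite -mulgA tperm2 mulg1.
exact: mcut_rmulh.
Qed.

Variable ec : R.
Hypotheses (r0 : (0 < r)%N) (Hec : is_eps_c r ec).

(** Convergence in probability gives a lower bound on the mean because [mcut] is nonnegative: on the
    bad event it is replaced by 0. *)
Lemma mean_mcut_ge (eta : R) : 0 < eta ->
  exists N, forall n, (N <= n)%N ->
    (r * n)%:R * (ec - eta) <= mean (fun s : hom r n => (mcut s)%:R : R).
Proof.
move=> eta0; pose eta' := eta / 2; have eta'0 : 0 < eta' by rewrite divr_gt0.
(* Chosen so that the bad event costs [(ec - eta') * theta <= eta']. *)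
pose theta := eta' / (`|ec| + 1); have theta0 : 0 < theta by rewrite divr_gt0// ltr_wpDl.
have [N HN] := Hec eta'0 theta0; exists N.+1 => n Nn.
have rn0 : 0 < (r * n)%:R :> R by rewrite ltr0n muln_gt0 r0 (leq_ltn_trans _ Nn).
have m0 : 0 <= mean (fun s : hom r n => (mcut s)%:R : R).
  by rewrite -[X in X <= _](mean_const r n); apply: ler_mean => s.
have [e0|e0] := leP (ec - eta') 0.
  by apply: le_trans m0; rewrite mulr_ge0_le0 ?ler0n//; move: e0; rewrite /eta'; lra.
have := HN n (ltnW Nn); set bad := [set s | _] => Hb.
have H : mean (fun s : hom r n => (r * n)%:R * (ec - eta') * (1 - (s \in bad)%:R)) <=
         mean (fun s : hom r n => (mcut s)%:R : R).
  apply: ler_mean => s; rewrite inE; case: ltP => [_|]; first by rewrite subrr mulr0.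
  rewrite subr0 mulr1 ler_distl => /andP[+ _].
  by rewrite ler_pdivlMr// mulrC.
apply: le_trans H; rewrite meanZ -mulrA ler_pM2l//.
have -> : mean (fun s : hom r n => 1 - (s \in bad)%:R) = 1 - #|bad|%:R / #|{: hom r n}|%:R :> R.
  rewrite -[in X in _ = X - _](mean_const r n (1 : R)) /mean -mulrBl; congr (_ / _).
  rewrite sumrB -sum1_card natr_sum [in RHS]big_mkcond/=; congr (_ - _).
  by rewrite [RHS]big_mkcond/=; apply: eq_bigr => s _; case: (_ \in _).
apply: (@le_trans _ _ ((ec - eta') * (1 - theta))); last first.
  by rewrite ler_pM2l// lerB.
have : (ec - eta') * theta <= eta'.
  rewrite /theta mulrA ler_pdivrMr ?ltr_wpDl// mulrC ler_pM2l//.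
  by have := ler_norm ec; lra.
by rewrite /eta'; lra.
Qed.

(** Chernoff bound with [expR (- t * mcut)]; half of [eta] is spent on the gap between the mean and
    [ec]. *)
Lemma mcut_tail (eta : R) : 0 < eta ->
  exists2 c, 0 < c & exists N, forall n, (N <= n)%N ->
    mean (fun s : hom r n => ((mcut s)%:R <= (r * n)%:R * (ec - eta))%R%:R) <= expR (- (c * n%:R)) :> R.
Proof.
move=> eta0; have [N HN] := mean_mcut_ge (divr_gt0 eta0 (ltr0Sn R 1)).
(* The bound 1/16 makes [2 * (t * 2)] at most 1/4. The bound [eta / 64] makes its square at most
   [t * eta / 4], half of the linear gain [t * eta / 2]. *)
pose t := Num.min (eta / 64) 16^-1; have t0 : 0 < t by rewrite lt_min; apply/andP; split; lra.
have t1 : t <= eta / 64 by rewrite ge_min lexx.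
have t2 : t <= 16^-1 by rewrite ge_min lexx orbT.
exists (r%:R * (t * eta / 4)); first by rewrite !mulr_gt0// ltr0n.
exists N => n Nn; set a := (r * n)%:R * (ec - eta).
apply: (@le_trans _ _ (mean (fun s : hom r n => expR (t * a) * expR (- t * (mcut s)%:R)))).
  apply: ler_mean => s; have [ma|_] := leP (mcut s)%:R a; last by rewrite mulr_ge0 ?expR_ge0.
  by rewrite -expRD -[leLHS]/1 -[leLHS]expR0 ler_expR mulNr subr_ge0 ler_pM2l.
rewrite meanZ; have tc : 2 * (`|- t| * 2) <= 4^-1.
  by rewrite normrN gtr0_norm//; lra.
have := mean_expR_le (@lip_mcut n) tc.
rewrite -(ler_pM2l (expR_gt0 (t * a))) => /le_trans; apply.
rewrite -expRD ler_expR normrN (gtr0_norm t0).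
have := HN n Nn; set m := mean _ => Hm.
have : t * ((r * n)%:R * (ec - eta / 2)) <= t * m by rewrite ler_pM2l.
have : (r * n)%:R * (2 * (t * 2)) ^+ 2 <= (r * n)%:R * (t * eta / 4).
  by rewrite ler_wpM2l ?ler0n//; nra.
by rewrite /a !natrM; lra.
Qed.

End McutTail.

(** * The ball of the Cayley tree *)

Section Words.
Variable r : nat.
Implicit Types (l : letter r) (w : word r).

Definition linv l : letter r := (l.1, ~~ l.2).

Lemma linvK : involutive linv.
Proof. by case=> i b; rewrite /linv /= negbK. Qed.

Lemma linv_neq l : (linv l == l) = false.
Proof. by case: l => i [] ; rewrite /linv xpair_eqE /= andbF. Qed.

Lemma cancelsE l l' : cancels l l' = (l == linv l').
Proof.
case: l l' => i b [j c]; rewrite /cancels /linv /= xpair_eqE; congr andb.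
by case: b; case: c.
Qed.

Lemma reducedE w : reduced w = sorted (fun l l' => ~~ cancels l l') w.
Proof. by elim: w => [|l [|l' w] IH]//=; congr andb; exact: IH. Qed.

Lemma reduced_rcons w l : reduced (rcons w l) = reduced w && (last l w != linv l).
Proof.
rewrite !reducedE; case: w => [|l' w]/=; first by rewrite eq_sym linv_neq.
by rewrite rcons_path cancelsE.
Qed.

Lemma reduced_behead w : reduced w -> reduced (behead w).
Proof. by rewrite !reducedE; case: w => [|l w]//=; exact: path_sorted. Qed.

(* [rmul l w] is the reduced form of [rcons w l]. *)
Definition rmul l w : word r :=
  if last l w == linv l then take (size w).-1 w else rcons w l.

Lemma rmul_rcons l w : rmul l (rcons w (linv l)) = w.
Proof. by rewrite /rmul last_rcons eqxx size_rcons -cats1 take_size_cat. Qed.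

Lemma rmul_last l w : last l w != linv l -> rmul l w = rcons w l.
Proof. by rewrite /rmul => /negPf->. Qed.

Variant rmul_spec l : word r -> word r -> Prop :=
| RmulCancel w : rmul_spec l (rcons w (linv l)) w
| RmulRcons w : last l w != linv l -> rmul_spec l w (rcons w l).

Lemma rmulP l w : rmul_spec l w (rmul l w).
Proof.
have [E|E] := eqVneq (last l w) (linv l); last by rewrite rmul_last//; constructor.
case/lastP: w E => [/eqP|w l']; first by rewrite eq_sym linv_neq.
by rewrite last_rcons => ->; rewrite rmul_rcons; constructor.
Qed.

Lemma reduced_rmul l w : reduced w -> reduced (rmul l w).
Proof. by case: w _ / (rmulP l w) => w; rewrite !reduced_rcons; [case/andP|move=> -> ->]. Qed.

Lemma rmulK l w : reduced w -> rmul (linv l) (rmul l w) = w.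
Proof.
case: w _ / (rmulP l w) => w; last by move=> _ _; rewrite -{2}(linvK l) rmul_rcons.
rewrite reduced_rcons => /andP[_ H]; rewrite rmul_last//.
Qed.

Lemma size_rmul_le l w : (size (rmul l w) <= (size w).+1)%N.
Proof. by case: w _ / (rmulP l w) => w; rewrite size_rcons// ltnW// ltnW. Qed.

(** Passing to the tree parent commutes with right multiplication by [l] except at the two ends of
    the edge that is reversed. *)
Lemma behead_rmul l w : w != [::] -> w != [:: linv l] -> behead (rmul l w) = rmul l (behead w).
Proof.
case: w _ / (rmulP l w) => w; first by case: w => [|l' w]//=; rewrite ?eqxx// rmul_rcons.
by case: w => [|l' w]//= H _ _; rewrite rmul_last//; case: w H => //= _; rewrite eq_sym linv_neq.
Qed.

Lemma rmul_nil l : rmul l [::] = [:: l].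
Proof. by rewrite rmul_last//= eq_sym linv_neq. Qed.

Lemma rmul_linv l : rmul l [:: linv l] = [::].
Proof. exact: (rmul_rcons l [::]). Qed.

End Words.

Section Ball.
Variables (r k : nat).

Definition wball := {w : k.-bseq (letter r) | reduced w}.
Definition bword (w : wball) : word r := val (val w).
Definition wball0 : wball := exist _ [bseq] isT.
(* [toball w] is the empty word when [w] is too long or not reduced. *)
Definition toball (w : word r) : wball := insubd wball0 (insubd ([bseq] : k.-bseq (letter r)) w).

Lemma bword_inj : injective bword.
Proof. by move=> u v /val_inj/val_inj. Qed.

Lemma bwordK w : reduced w -> (size w <= k)%N -> bword (toball w) = w.
Proof.
move=> rw sw; have E : val (insubd ([bseq] : k.-bseq (letter r)) w) = w by rewrite val_insubd sw.
by rewrite /bword /toball val_insubd E rw.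
Qed.

Lemma tobalK w : toball (bword w) = w.
Proof.
apply: bword_inj; rewrite bwordK//; first by case: w.
by rewrite /bword; case: (val w).
Qed.

Lemma bword_reduced w : reduced (bword w). Proof. by case: w. Qed.
Lemma bword_size w : (size (bword w) <= k)%N. Proof. by rewrite /bword; case: (val w). Qed.

Definition bpar (w : wball) := toball (behead (bword w)).

Lemma bword_par w : bword (bpar w) = behead (bword w).
Proof.
rewrite bwordK ?reduced_behead ?bword_reduced// size_behead.
by rewrite (leq_trans (leq_pred _)) ?bword_size.
Qed.

Lemma bword_eq0 w : (bword w == [::]) = (w == wball0).
Proof. by rewrite -(inj_eq bword_inj). Qed.

(** The overlap of the balls around [v] and [l v], indexed from [l v]. *)
Definition inner (l : letter r) := [set w : wball | (size (rmul l (bword w)) <= k)%N].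
Definition endwith (l : letter r) := [set w : wball | (w != wball0) && (last l (bword w) == l)].

Lemma last_dflt (l l' : letter r) (w : wball) : w != wball0 -> last l (bword w) = last l' (bword w).
Proof. by rewrite -bword_eq0; case: (bword w). Qed.

(** Words of the overlap ending in [linv l] are shortened and always fit; the others are lengthened,
    and appending [l] maps them onto the nonempty words ending in [l]. *)
Lemma card_inner l : #|inner l| = (#|endwith l| + #|endwith (linv l)|)%N.
Proof.
rewrite addnC -(cardsID [set w : wball | last l (bword w) == linv l] (inner l)); congr addn.
  apply: eq_card => w; rewrite !inE.
  have [->|w0] := eqVneq w wball0; first by rewrite /= andbC eq_sym linv_neq.
  rewrite /= (last_dflt l (linv l) w0); case: eqP => [E|_]; last by rewrite andbF.
  rewrite andbT (leq_trans _ (bword_size w))//.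
  by move: E; rewrite (last_dflt _ l w0); case: rmulP => [u _|u /eqP//]; rewrite size_rcons ltnW.
rewrite -(card_in_imset (f := fun w : wball => toball (rmul l (bword w)))); last first.
  move=> u v; rewrite !inE => /andP[_ su] /andP[_ sv] /(congr1 bword).
  rewrite !bwordK ?reduced_rmul ?bword_reduced// => /(congr1 (rmul (linv l))).
  by rewrite !rmulK ?bword_reduced//; exact: bword_inj.
apply: eq_card => w; rewrite inE; apply/imsetP/andP => [[u]|[w0]].
  rewrite !inE => /andP[lu su] ->.
  rewrite -bword_eq0 bwordK ?reduced_rmul ?bword_reduced//.
  move: lu; case: rmulP => [v|v _ _]; first by rewrite last_rcons eqxx.
  by rewrite last_rcons eqxx; case: v.
move=> lw; have [v wE] : exists v, bword w = rcons v l.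
  move: w0 lw; rewrite -bword_eq0; case/lastP: (bword w) => // v l'.
  by rewrite last_rcons => _ /eqP->; exists v.
have := bword_reduced w; have := bword_size w; rewrite wE reduced_rcons size_rcons => sv /andP[rv lv].
have uE : bword (toball v) = v by rewrite bwordK// ltnW.
by exists (toball v); rewrite ?inE uE rmul_last// ?lv ?size_rcons// -wE tobalK.
Qed.

(** Every nonempty word of the ball has exactly one last letter. The right side is the number of
    edges of the ball. *)
Lemma sum_card_inner : (0 < r)%N -> (\sum_(i < r) #|inner (i, false)| = #|{: wball}|.-1)%N.
Proof.
move=> rpos; under eq_bigr do rewrite card_inner.
have -> : (\sum_(i < r) (#|endwith (i, false)| + #|endwith (linv (i, false))|) =
           \sum_(l : letter r) #|endwith l|)%N.
  rewrite (eq_bigr (fun i => \sum_(b : bool) #|endwith (i, b)|)%N) => [|i _].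
    by rewrite pair_bigA/=; apply: eq_bigr => -[].
  by rewrite big_bool addnC.
rewrite -(cardC1 wball0); pose l0 : letter r := (Ordinal rpos, false).
rewrite -[RHS]sum1_card (partition_big (fun w : wball => last l0 (bword w)) xpredT)//=.
apply: eq_bigr => l _; rewrite sum1dep_card; apply: eq_card => w; rewrite !inE.
by case: eqVneq => //= w0; rewrite (last_dflt l l0 w0).
Qed.

End Ball.

(** * The Ising measure on a ball *)

Section EntropyProd.
Variables (R : realType) (I J : finType) (g : I -> J -> R).
Hypotheses (g0 : forall i b, 0 <= g i b) (g1 : forall i, \sum_b g i b = 1).

Lemma sum_prod_ffun : \sum_(f : {ffun I -> J}) \prod_i g i (f i) = 1.
Proof. by rewrite -(bigA_distr_bigA g) big1. Qed.

Lemma entropy_prod :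
  entropy (fun f : {ffun I -> J} => \prod_i g i (f i)) = \sum_i entropy (g i).
Proof.
rewrite /entropy sumrN; congr (- _).
rewrite (eq_bigr (fun f : {ffun I -> J} => \sum_i (\prod_j g j (f j)) * ln (g i (f i)))); last first.
  move=> f _; rewrite -mulr_sumr.
  (* The logarithm splits only for positive factors; if one vanishes, the weight in front kills both
     sides. *)
  have [/existsP[i /eqP i0]|] := boolP [exists i, g i (f i) == 0].
    by rewrite (bigD1 i)//= i0 !mul0r.
  rewrite negb_exists => /forallP fn; congr (_ * _).
  have fp i : 0 < g i (f i) by rewrite lt_def fn g0.
  exact: ln_prod.
rewrite exchange_big/=; apply: eq_bigr => i _.
rewrite (eq_bigr (fun f : {ffun I -> J} => \prod_j (g j (f j) * (if j == i then ln (g i (f j)) else 1)))); last first.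
  by move=> f _; rewrite big_split/= -big_mkcond big_pred1_eq.
rewrite -(bigA_distr_bigA (fun j b => g j b * (if j == i then ln (g i b) else 1)))/=.
rewrite (bigD1 i)//= [X in _ * X]big1 ?mulr1 => [|j ji].
  by apply: eq_bigr => b _; rewrite eqxx.
by under eq_bigr do rewrite (negPf ji) mulr1.
Qed.

End EntropyProd.

Section BallMeasure.
Variables (R : realType) (r k : nat) (e : R).
Hypotheses (e0 : 0 < e) (e1 : e < 1).
Local Notation wball := (wball r k).
Local Notation config := {ffun wball -> bool}.
Implicit Types (w u : wball) (y z : config) (l : letter r).

Lemma toball_out (v : word r) : (k < size v)%N -> toball k v = wball0 r k.
Proof.
move=> kv; apply: bword_inj; rewrite /bword /toball val_insubd.
have E : val (insubd ([bseq] : k.-bseq (letter r)) v) = [::] by rewrite val_insubd leqNgt kv.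
by rewrite E.
Qed.

Definition flipw (b : bool) : R := if b then e else 1 - e.

Lemma trans_flip a b : trans e a b = flipw (a (+) b).
Proof. by case: a; case: b. Qed.

Lemma flipw_gt0 b : 0 < flipw b.
Proof. by case: b => //=; rewrite subr_gt0. Qed.

Lemma flipw_entropy : entropy flipw = binent e.
Proof. by rewrite /entropy big_bool /= addrC. Qed.

Definition bweight w b : R := if w == wball0 r k then 2^-1 else flipw b.

Lemma bweight_gt0 w b : 0 < bweight w b.
Proof. by rewrite /bweight; case: eqP => _; rewrite ?flipw_gt0. Qed.

Lemma bweight_sum w : \sum_b bweight w b = 1.
Proof. by rewrite big_bool /bweight; case: eqP => _ /=; lra. Qed.

(* The root spin together with the spin flips along the edges of the ball. *)
Definition flips y : config :=
  [ffun w => if w == wball0 r k then y w else y (bpar w) (+) y w].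

Lemma flips_inj : injective flips.
Proof.
move=> y z yz; apply/ffunP.
suff H m w : (size (bword w) <= m)%N -> y w = z w by move=> w; exact: (H k _ (bword_size w)).
elim: m w => [|m IH] w sw; have := congr1 (fun f : config => f w) yz; rewrite !ffunE -bword_eq0.
  by move: sw; rewrite leqn0 size_eq0 => ->.
case: eqVneq => // w0; rewrite (IH (bpar w)).
  by move/(congr1 (addb (z (bpar w)))); rewrite !addbA addbb.
by rewrite bword_par size_behead -ltnS prednK// lt0n size_eq0.
Qed.

Lemma sum_flips (F : config -> R) : \sum_y F (flips y) = \sum_z F z.
Proof. by rewrite [RHS](reindex_inj flips_inj). Qed.

(* The Ising law of the spins on the ball. *)
Definition pmeas y : R := \prod_w bweight w (flips y w).

Lemma pmeas_gt0 y : 0 < pmeas y.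
Proof. by apply: prodr_gt0 => w _; exact: bweight_gt0. Qed.

Lemma pmeas_sum : \sum_y pmeas y = 1.
Proof.
rewrite (sum_flips (fun z => \prod_w bweight w (z w))).
by rewrite sum_prod_ffun//; exact: bweight_sum.
Qed.

Lemma pmeas_entropy : entropy pmeas = ln 2 + #|{: wball}|.-1%:R * binent e.
Proof.
rewrite /entropy /pmeas.
rewrite (sum_flips (fun z => (\prod_w bweight w (z w)) * ln (\prod_w bweight w (z w)))).
rewrite -[LHS]/(entropy (fun z : config => \prod_w bweight w (z w))) entropy_prod; last 2 first.
- by move=> w b; exact/ltW/bweight_gt0.
- exact: bweight_sum.
rewrite (bigD1 (wball0 r k))//=; congr (_ + _).
  rewrite /entropy big_bool /bweight eqxx lnV ?posrE// /=; lra.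
rewrite (eq_bigr (fun=> binent e)) ?sumr_const ?cardC1 ?mulr_natl//.
by move=> w w0; rewrite -flipw_entropy /entropy /bweight (negPf w0).
Qed.

(** On the overlap the spin is copied. Off it, [w l] lies one step outside the ball around [v] but
    its parent lies inside, so the spin is a fresh transition from the parent. *)
Definition qker l y w (b : bool) : R :=
  if w \in inner k l then (b == y (toball k (rmul l (bword w))))%:R
  else trans e (y (toball k (behead (rmul l (bword w))))) b.

(* The Ising law of the pair of configurations on the balls around [v] and
   around [l v]; [qker] is the conditional law of the second given the first. *)
Definition qmeas l (yy : config * config) : R := pmeas yy.1 * \prod_w qker l yy.1 w (yy.2 w).

Lemma qker_ge0 l y w b : 0 <= qker l y w b.
Proof. by rewrite /qker; case: ifP => _; rewrite ?ler0n// trans_flip ltW ?flipw_gt0. Qed.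

Lemma qker_sum l y w : \sum_b qker l y w b = 1.
Proof.
rewrite /qker; case: (w \in inner k l); last exact: trans_sum.
by rewrite big_bool; case: (y (toball k (rmul l (bword w)))); rewrite /= ?addr0 ?add0r.
Qed.

Lemma qmeas_row l y : \sum_y' qmeas l (y, y') = pmeas y.
Proof.
by rewrite /qmeas/= -mulr_sumr (sum_prod_ffun (g := qker l y)) ?mulr1//; exact: qker_sum.
Qed.

Lemma qker_entropy l y w : entropy (qker l y w) = (w \notin inner k l)%:R * binent e.
Proof.
rewrite /entropy /qker; case: (w \in inner k l) => /=.
  rewrite mul0r big1 ?oppr0// => b _; case: eqP => _; by rewrite ?ln1 ?mulr0 ?mul0r.
rewrite mul1r big_bool /trans /binent.
by case: (y (toball k (behead (rmul l (bword w))))) => /=; rewrite ?(addrC (e * _)).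
Qed.

(** Chain rule: given the first configuration, each vertex off the overlap is an independent flip of
    entropy h, and the others are determined. *)
Lemma qmeas_entropy l :
  entropy (qmeas l) = entropy pmeas + (#|{: wball}| - #|inner k l|)%:R * binent e.
Proof.
have -> : entropy (qmeas l) =
    \sum_y (- (pmeas y * ln (pmeas y)) + pmeas y * entropy (fun y' : config => \prod_w qker l y w (y' w))).
  rewrite /entropy -(pair_bigA _ (fun y y' => qmeas l (y, y') * ln (qmeas l (y, y'))))/=.
  rewrite -sumrN; apply: eq_bigr => y _; rewrite mulrN mulr_sumr -opprD; congr (- _).
  have -> : pmeas y * ln (pmeas y) =
      \sum_(y' : config) pmeas y * ln (pmeas y) * \prod_w qker l y w (y' w).
    by rewrite -mulr_sumr (sum_prod_ffun (@qker_sum l y)) mulr1.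
  rewrite -big_split/=.
  apply: eq_bigr => y' _; rewrite /qmeas/=; set Q := \prod_w _.
  have Q0 : 0 <= Q by apply: prodr_ge0 => w _; exact: qker_ge0.
  have [->|Qn] := eqVneq Q 0; first by rewrite !(mulr0, mul0r) addr0.
  have Qp : 0 < Q by rewrite lt_def Qn.
  by rewrite lnM ?posrE ?pmeas_gt0//; ring.
rewrite big_split/= sumrN; congr (_ + _).
rewrite (eq_bigr (fun y => pmeas y * ((#|{: wball}| - #|inner k l|)%:R * binent e))).
  by rewrite -mulr_suml pmeas_sum mul1r.
move=> y _; rewrite entropy_prod; last 2 first.
- exact: qker_ge0.
- exact: qker_sum.
under eq_bigr do rewrite qker_entropy.
rewrite -mulr_suml -natr_sum; congr (_ * (_%:R * _)).
rewrite -(cardsC (inner k l)) addKn -sum1_card [RHS]big_mkcond/=.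
by apply: eq_bigr => w _; rewrite finset.in_setC; case: (w \in inner k l).
Qed.

(** With B the size of the ball, the left side is (1 - r)(ln 2 + (B - 1) h) + (r B - (B - 1)) h, and
    B cancels. *)
Lemma ball_entropy : (0 < r)%N ->
  \sum_(i < r) entropy (qmeas (i, false)) - (2 * r%:R - 1) * entropy pmeas = f_Ising r e.
Proof.
move=> r0; under eq_bigr do rewrite qmeas_entropy.
rewrite big_split/= sumr_const card_ord -mulr_suml -natr_sum.
have -> : ((\sum_(i < r) (#|{: wball}| - #|inner k (i, false)|))%N)%:R =
          r%:R * #|{: wball}|%:R - #|{: wball}|.-1%:R :> R.
  rewrite -(sum_card_inner k r0) -natrM -[X in (X * _)%N](card_ord r) -sum_nat_const.
  rewrite natr_sum [in RHS]natr_sum natr_sum -sumrB.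
  by apply: eq_bigr => i _; rewrite natrB// max_card.
rewrite pmeas_entropy /f_Ising -[_ *+ r]mulr_natl.
have -> : #|{: wball}|%:R = #|{: wball}|.-1%:R + 1 :> R.
  by rewrite natr1 prednK//; apply/card_gt0P; exists (wball0 r k).
ring.
Qed.

End BallMeasure.

(** * Reversibility and integrality of the two-ball law *)

Section Symmetry.
Variables (R : realType) (r k : nat) (e : R).
Hypotheses (k0 : (0 < k)%N).
Local Notation ball := (wball r k).
Local Notation config := {ffun ball -> bool}.
Local Notation o := (wball0 r k).
Implicit Types (w u : ball) (y z : config) (l : letter r).

Definition compat l y y' :=
  [forall w, (w \in inner k l) ==> (y' w == y (toball k (rmul l (bword w))))].

(** The vertex [w] of the ball around [l v] is the vertex [w l] seen from [v]. *)
Definition brmul l w := toball k (rmul l (bword w)).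

Lemma bword_brmul l w : w \in inner k l -> bword (brmul l w) = rmul l (bword w).
Proof. by rewrite inE => wl; rewrite bwordK// reduced_rmul// bword_reduced. Qed.

Lemma brmul_inner l w : w \in inner k l -> brmul l w \in inner k (linv l).
Proof.
by move=> wl; rewrite inE bword_brmul// rmulK ?bword_size// bword_reduced.
Qed.

Lemma brmulK l w : w \in inner k l -> brmul (linv l) (brmul l w) = w.
Proof.
by move=> wl; rewrite {1}/brmul bword_brmul// rmulK ?bword_reduced// tobalK.
Qed.

Lemma compatP l y y' : reflect (forall w, w \in inner k l -> y' w = y (brmul l w)) (compat l y y').
Proof.
apply: (iffP forallP) => H w; last by apply/implyP => /H ->.
by move=> wl; apply/eqP; exact: (implyP (H w)).
Qed.

Lemma compat_sym l y y' : compat l y y' -> compat (linv l) y' y.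
Proof.
move=> /compatP H; apply/compatP => w wl.
have := brmul_inner wl; rewrite linvK => /H ->.
by have := brmulK wl; rewrite linvK => ->.
Qed.

Lemma qmeas_incompat l y y' : ~~ compat l y y' -> qmeas e l (y, y') = 0.
Proof.
rewrite negb_forall => /existsP[w]; rewrite negb_imply => /andP[wl yw].
by rewrite /qmeas/= (bigD1 w)//= {1}/qker wl (negPf yw) mul0r mulr0.
Qed.

Lemma nil_inner l : o \in inner k l.
Proof. by rewrite inE /= rmul_nil. Qed.

Lemma par_inner l w : w != o -> bword w != [:: linv l] -> bpar w \in inner k l.
Proof.
move=> w0 wl; rewrite inE bword_par -behead_rmul// ?bword_eq0// size_behead.
by rewrite -subn1 leq_subLR add1n (leq_trans (size_rmul_le _ _))// ltnS bword_size.
Qed.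

Lemma notin_inner l w : w \notin inner k l -> w != o /\ bword w != [:: linv l].
Proof.
move=> wl; split; apply: contraNneq wl; first by move=> ->; exact: nil_inner.
by move=> w1; rewrite inE w1 rmul_linv.
Qed.

Lemma brmul_par l w : w != o -> bword w != [:: linv l] ->
  brmul l (bpar w) = toball k (behead (rmul l (bword w))).
Proof. by move=> w0 wl; rewrite /brmul bword_par behead_rmul// bword_eq0. Qed.

Lemma bweight_qker l y y' w : compat (linv l) y y' -> w \notin inner k l ->
  bweight e w (flips y w) = qker e l y' w (y w).
Proof.
move=> /compat_sym; rewrite linvK => /compatP H wl; have [w0 w1] := notin_inner wl.
rewrite /qker (negPf wl) /bweight ffunE (negPf w0) -trans_flip; congr (trans e _ _).
by rewrite (H _ (par_inner w0 w1)) brmul_par.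
Qed.

Lemma flips_brmul l y y' w : compat (linv l) y y' -> w \in inner k l ->
  w != o -> bword w != [:: linv l] -> flips y w = flips y' (brmul l w).
Proof.
move=> /compat_sym; rewrite linvK => /compatP H wl w0 w1; rewrite !ffunE (negPf w0).
have wr : (brmul l w == o) = false.
  apply/negbTE; apply: contraNneq w1 => /(congr1 (@bword r k)); rewrite bword_brmul// => E.
  by rewrite -(rmulK l (bword_reduced w)) E rmul_nil.
rewrite wr (H _ wl) (H _ (par_inner w0 w1)) brmul_par//; congr (y' _ (+) _).
apply: bword_inj; rewrite bword_par bword_brmul// bwordK ?reduced_behead ?reduced_rmul ?bword_reduced//.
by move: wl; rewrite inE size_behead; apply: leq_trans; exact: leq_pred.
Qed.

Lemma bword1 l : bword (toball k [:: l]) = [:: l].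
Proof. by rewrite bwordK. Qed.

(** Right multiplication matches the edges of the two overlaps. It reverses only the edge joining
    the two centres, whose weight is symmetric; the root weights agree. *)
Lemma prod_inner_flips l y y' : compat (linv l) y y' ->
  \prod_(w in inner k l) bweight e w (flips y w) =
  \prod_(w in inner k (linv l)) bweight e w (flips y' w).
Proof.
move=> yy'; pose s l := toball k [:: l].
have brs : brmul l (s (linv l)) = o.
  by rewrite /brmul bword1 rmul_linv; apply: bword_inj; rewrite bwordK.
have bro : brmul l o = s l by rewrite /brmul [bword o]/= rmul_nil.
have s0 l' : s l' != o by rewrite -bword_eq0 bword1.
have sin l' : s (linv l') \in inner k l' by rewrite inE bword1 rmul_linv.
have sin' : s l \in inner k (linv l) by have := sin (linv l); rewrite linvK.
rewrite (bigD1 o) ?nil_inner//= [RHS](bigD1 o) ?nil_inner//=.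
congr (_ * _).
rewrite (bigD1 (s (linv l))) ?sin ?s0//= [RHS](bigD1 (s l)) ?sin' ?s0//=.
congr (_ * _).
  rewrite /bweight !(negPf (s0 _)) !ffunE !(negPf (s0 _)).
  have par0 l' : bpar (s l') = o by apply: bword_inj; rewrite bword_par bword1.
  have /compatP H := yy'; have /compatP H' := compat_sym yy'; rewrite linvK in H'.
  rewrite !par0 (H' _ (sin l)) (H' _ (nil_inner l)).
  by rewrite brs bro addbC.
rewrite [RHS](reindex_onto (brmul l) (brmul (linv l)))/=; last first.
  by move=> w /andP[/andP[wl _] _]; have := brmulK wl; rewrite linvK.
apply: eq_big => [w|w /andP[/andP[wl w0] w1]]; last first.
  have w1' : bword w != [:: linv l] by rewrite -(inj_eq (@bword_inj _ _)) bword1 in w1.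
  have wr : (brmul l w == o) = false.
    apply/negbTE; apply: contraNneq w1' => /(congr1 (@bword r k)); rewrite bword_brmul// => E.
    by rewrite -(rmulK l (bword_reduced w)) E rmul_nil.
  by rewrite (flips_brmul yy')// /bweight (negPf w0) wr.
have [wl|wl] := boolP (w \in inner k l); last first.
  (* Off the overlap [brmul] takes its default value, the root, which the product already
     excludes. *)
  have -> : brmul l w = o by rewrite /brmul toball_out//; move: wl; rewrite inE -ltnNge.
  by rewrite eqxx !andbF.
have inj u : u \in inner k l -> (brmul l w == brmul l u) = (w == u).
  move=> ul; apply/eqP/eqP => [E|->//].
  by rewrite -(brmulK wl) -(brmulK ul) E.
have E1 : (brmul l w == o) = (w == s (linv l)) by rewrite -{1}brs inj.
have E2 : (brmul l w == s l) = (w == o) by rewrite -bro inj ?nil_inner.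
by rewrite brmul_inner// brmulK// eqxx andbT E1 E2 /= andbC.
Qed.

(** Both sides are the Ising weight of the union of the two balls: the overlap times the fresh edges
    on either side. *)
Lemma qmeas_sym l y y' : qmeas e l (y, y') = qmeas e (linv l) (y', y).
Proof.
have [yy|yy] := boolP (compat l y y'); last first.
  rewrite !qmeas_incompat//; apply: contraNN yy => /compat_sym.
  by rewrite linvK.
have yy' := compat_sym yy.
have ker_inner l' z z' : compat l' z z' ->
    \prod_w qker e l' z w (z' w) = \prod_(w | w \notin inner k l') qker e l' z w (z' w).
  move=> /compatP H; rewrite (bigID (mem (inner k l')))/= big1 ?mul1r// => w wl.
  by rewrite /qker wl (H _ wl) /brmul eqxx.
have split_p l' z z' : compat (linv l') z z' -> pmeas e z =
    (\prod_(w in inner k l') bweight e w (flips z w)) *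
    (\prod_(w | w \notin inner k l') qker e l' z' w (z w)).
  move=> zz; rewrite /pmeas (bigID (mem (inner k l')))/=; congr (_ * _).
  by apply: eq_bigr => w wl; exact: bweight_qker.
rewrite /qmeas/= (ker_inner _ _ _ yy) (ker_inner _ _ _ yy').
rewrite (split_p (linv l) y y') ?linvK// (split_p l y' y)//.
rewrite (@prod_inner_flips (linv l) y y') ?linvK//.
ring.
Qed.

Lemma qmeas_col l y' : 0 < e -> e < 1 -> \sum_y qmeas e l (y, y') = pmeas e y'.
Proof.
by move=> e0 e1; under eq_bigr do rewrite qmeas_sym; exact: qmeas_row.
Qed.

Lemma qmeas_integral (a b : nat) : (0 < b)%N -> (a <= b)%N -> e = a%:R / b%:R ->
  exists2 D, (0 < D)%N &
   (exists N0 : config -> nat, forall y, (N0 y)%:R = D%:R * pmeas e y) /\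
   (exists N : letter r -> config * config -> nat, forall l yy, (N l yy)%:R = D%:R * qmeas e l yy).
Proof.
move=> b0 ab eE; have bR : b%:R != 0 :> R by rewrite pnatr_eq0 -lt0n.
have tN x : exists m : nat, b%:R * flipw e x = m%:R.
  case: x => /=; first by exists a; rewrite eE mulrC divfK.
  by exists (b - a)%N; rewrite natrB// eE mulrBr mulr1 [_ * (_ / _)]mulrC divfK.
have wN w x : exists m : nat, (2 * b)%:R * bweight e w x = m%:R.
  rewrite /bweight; case: eqP => _; first by exists b; rewrite natrM mulrAC divff ?mul1r ?pnatr_eq0.
  by have [m mE] := tN x; exists (2 * m)%N; rewrite natrM -mulrA mE natrM.
have kN l y w x : exists m : nat, (2 * b)%:R * qker e l y w x = m%:R.
  rewrite /qker; case: ifP => _; first by exists (2 * b * (x == y (toball k (rmul l (bword w)))))%N; rewrite !natrM.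
  rewrite trans_flip; set c := _ (+) _; have [m mE] := tN c.
  by exists (2 * m)%N; rewrite natrM -mulrA mE natrM.
have prodN (F : ball -> R) : (forall w, exists m : nat, (2 * b)%:R * F w = m%:R) ->
    exists m : nat, ((2 * b) ^ #|{: ball}|)%:R * \prod_w F w = m%:R.
  move=> FN; have [f fE] := choice FN; exists (\prod_w f w)%N.
  by rewrite natr_prod natrX -prodr_const -big_split/=; apply: eq_bigr => w _; rewrite fE.
(* One factor [2 * b] clears the denominator of each vertex weight; [qmeas] has two weights per
   vertex of the ball, hence [D = B * B]. *)
pose B := ((2 * b) ^ #|{: ball}|)%N.
have B0 : (0 < B)%N by rewrite expn_gt0 muln_gt0 b0.
have pN y : exists m : nat, B%:R * pmeas e y = m%:R by apply: prodN => w; exact: wN.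
exists (B * B)%N; first by rewrite muln_gt0 B0.
split.
  have [f fE] := choice pN; exists (fun y => B * f y)%N => y.
  by rewrite natrM -fE natrM mulrA.
have qN l (yy : config * config) : exists m : nat, (B * B)%:R * qmeas e l yy = m%:R.
  have [m1 E1] := pN yy.1; have [m2 E2] := prodN (fun w => qker e l yy.1 w (yy.2 w)) (fun w => kN _ _ _ _).
  by exists (m1 * m2)%N; rewrite !natrM -E1 -E2 /qmeas -/B; ring.
have [f fE] := choice (fun ly : letter r * (config * config) => qN ly.1 ly.2).
by exists (fun l yy => f (l, yy)) => l yy; rewrite (fE (l, yy)).
Qed.

End Symmetry.

(** * Agreement of the recursive Ising measure with the law on a ball *)

Section SumFree.
Variables (R : realType) (I : finType) (S : {set I}).
Variables (Phi : {ffun I -> bool} -> R) (g : I -> bool -> {ffun I -> bool} -> R).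
Hypothesis indep : forall y y' : {ffun I -> bool}, (forall i, i \notin S -> y i = y' i) ->
  Phi y = Phi y' /\ forall i b, i \in S -> g i b y = g i b y'.

(** The sum is doubled by an independent copy [u] and the coordinates in [S] are swapped by an
    involution. The spins of [y] on [S] stay as dummies, compensated by [2^-1]. *)
Lemma sum_free_coords :
  \sum_y Phi y * \prod_(i in S) g i (y i) y =
  \sum_y Phi y * \prod_(i in S) (2^-1 * \sum_b g i b y).
Proof.
pose merge (y u : {ffun I -> bool}) : {ffun I -> bool} := [ffun i => if i \in S then u i else y i].
pose sw (p : {ffun I -> bool} * {ffun I -> bool}) := (merge p.1 p.2, merge p.2 p.1).
have swK : involutive sw.
  by move=> [y u]; congr pair; apply/ffunP => i; rewrite !ffunE /= ?ffunE; case: (i \in S).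
pose N : R := #|{: {ffun I -> bool}}|%:R.
have N0 : N != 0 by rewrite pnatr_eq0 -lt0n card_ffun expn_gt0 card_bool.
apply: (mulfI N0).
have -> : N * (\sum_y Phi y * \prod_(i in S) g i (y i) y) =
    \sum_y \sum_(u : {ffun I -> bool}) Phi y * \prod_(i in S) g i (u i) y.
  rewrite mulr_sumr (eq_bigr (fun y => \sum_(u : {ffun I -> bool}) Phi y * \prod_(i in S) g i (y i) y)); last first.
    by move=> y _; rewrite sumr_const mulr_natl.
  rewrite !pair_bigA/= (reindex_inj (inv_inj swK))/=; apply: eq_bigr => -[y u] _ /=.
  have [E1 E2] : Phi (merge y u) = Phi y /\ forall i b, i \in S -> g i b (merge y u) = g i b y.
    by apply: indep => i iS; rewrite ffunE (negPf iS).
  by rewrite E1; congr (_ * _); apply: eq_bigr => i iS; rewrite ffunE iS E2.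
rewrite mulr_sumr; apply: eq_bigr => y _; rewrite -mulr_sumr mulrCA; congr (_ * _).
rewrite (eq_bigr (fun u : {ffun I -> bool} => \prod_i (if i \in S then g i (u i) y else 1))); last first.
  by move=> u _; rewrite big_mkcond.
rewrite -(bigA_distr_bigA (fun i b => if i \in S then g i b y else 1))/=.
have -> : N = \prod_(i : I) 2 by rewrite /N card_ffun card_bool prodr_const natrX.
rewrite [X in _ = _ * X]big_mkcond -big_split/=; apply: eq_bigr => i _.
by case: ifP => _; rewrite big_bool /= ?mulr1// mulrA divff ?mul1r// pnatr_eq0.
Qed.
End SumFree.

Section IsingBall.
Variables (R : realType) (r k : nat) (e : R).
Local Notation ball := (wball r k).
Local Notation config := {ffun ball -> bool}.
Local Notation o := (wball0 r k).
Implicit Types (w u : ball) (y z : config) (l : letter r) (c : cyl r bool).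

Lemma agreeE c (v : word r) a :
  agree R c v a = (all (fun p => (val p.1 == v) ==> (p.2 == a)) c)%:R.
Proof. by rewrite /agree; case: ifP. Qed.

(** Generations below all the constraints sum to 1, as the rows of the transition matrix do. *)
Lemma lik_stable c m (v : word r) a :
  all (fun p => size (val p.1) <= size v + m)%N c -> lik e c m.+1 v a = lik e c m v a.
Proof.
elim: m v a => [|m IH] v a cm.
  rewrite /=; congr (_ * _); rewrite big1// => l _; rewrite -[RHS](trans_sum e a).
  apply: eq_bigr => b _; rewrite mulr1 agreeE.
  rewrite (_ : all _ c = true) ?mulr1//; apply/allP => p pc; apply/implyP => /eqP pv.
  by have := allP cm _ pc; rewrite pv /= addn0 ltnn.
rewrite [LHS]/= [RHS]/=; congr (_ * _); apply: eq_bigr => l _; apply: eq_bigr => b _.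
by congr (_ * _); apply: IH; apply: sub_all cm => p; rewrite /= addSnnS.
Qed.

Lemma Ising_lik c : all (fun p => size (val p.1) <= k)%N c ->
  Ising e c = \sum_(a : bool) 2^-1 * lik e c k [::] a.
Proof.
move=> ck; rewrite /Ising; set K := \max_(p <- c) _.
have cK m : (K <= m)%N -> all (fun p => size (val p.1) <= size ([::] : word r) + m)%N c.
  move=> Km; apply/allP => p pc; rewrite add0n (leq_trans _ Km)//.
  exact: leq_bigmax_seq.
have Kk : (K <= k)%N by apply/bigmax_leqP_seq => p pc _; exact: (allP ck).
apply: eq_bigr => a _; congr (_ * _); rewrite -(subnKC Kk).
elim: (k - K)%N => [|m IH]; first by rewrite addn0.
by rewrite addnS lik_stable// cK// leq_addr.
Qed.

(* Interpolates between the product over the ball ([j = k]) and the tree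
   recursion [lik] ([j = 0]). *)
Definition level c j w y : R :=
  if (size (bword w) <= j)%N then
    bweight e w (flips y w) *
    (if size (bword w) == j then lik e c (k - j) (bword w) (y w) else agree R c (bword w) (y w))
  else 2^-1.

Lemma level_last c : \sum_(y : config) \prod_w level c k w y =
  \sum_(y : config) pmeas e y * \prod_w agree R c (bword w) (y w).
Proof.
apply: eq_bigr => y _; rewrite /pmeas -big_split/=; apply: eq_bigr => w _.
by rewrite /level bword_size subnn /= mulr1; case: ifP.
Qed.

Lemma level_first c : \sum_(y : config) \prod_w level c 0 w y = \sum_(a : bool) 2^-1 * lik e c k [::] a.
Proof.
rewrite (eq_bigr (fun y => \prod_w (2^-1 * if w == o then lik e c k [::] (y w) else 1))); last first.
  move=> y _; apply: eq_bigr => w _; rewrite /level leqn0 size_eq0 bword_eq0.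
  have [->|w0] := eqVneq w o; last by rewrite mulr1.
  by rewrite /bweight eqxx subn0.
rewrite -(bigA_distr_bigA (fun w a => 2^-1 * if w == o then lik e c k [::] a else 1))/=.
rewrite (bigD1 o)//= [X in _ * X]big1 ?mulr1 => [//|w w0].
by rewrite (negPf w0) big_bool /=; lra.
Qed.

(** Sums out the spins of the words of length [j + 1]; the resulting factors are the child sums in
    the recursion for [lik] at length [j]. *)
Lemma level_step c j : (j < k)%N ->
  \sum_(y : config) \prod_w level c j.+1 w y = \sum_(y : config) \prod_w level c j w y.
Proof.
move=> jk; pose S := [set w : ball | size (bword w) == j.+1].
have size_S w : w \in S -> [/\ size (bword w) = j.+1, (w == o) = false & size (bword (bpar w)) = j].
  rewrite inE => /eqP sw; split=> //; last by rewrite bword_par size_behead sw.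
  by apply/negbTE; rewrite -bword_eq0 -size_eq0 sw.
pose Phi y := \prod_(w | w \notin S) level c j.+1 w y.
pose G w b y : R := bweight e w (y (bpar w) (+) b) * lik e c (k - j.+1) (bword w) b.
have -> : \sum_(y : config) \prod_w level c j.+1 w y = \sum_(y : config) Phi y * \prod_(w in S) G w (y w) y.
  apply: eq_bigr => y _; rewrite (bigID (mem S))/= mulrC; congr (_ * _).
  apply: eq_bigr => w /size_S[sw w0 _].
  by rewrite /level sw leqnn eqxx /flips ffunE w0.
rewrite sum_free_coords; last first.
  move=> y y' yy; split; last first.
    move=> w b /size_S[_ _ sp]; rewrite /G yy// inE sp.
    by rewrite neq_ltn ltnSn.
  apply: eq_bigr => w; rewrite inE => wS; rewrite /level.
  case: (leqP (size (bword w)) j.+1) => // wj.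
  have wj' : (size (bword w) < j.+1)%N by rewrite ltn_neqAle wS.
  rewrite (negPf wS) (yy w) ?inE//; congr (bweight _ _ _ * _).
  rewrite !ffunE (yy w) ?inE// (yy (bpar w))// inE bword_par size_behead.
  by rewrite neq_ltn (leq_ltn_trans (leq_pred _) wj').
apply: eq_bigr => y _.
rewrite [RHS](bigID (mem S))/= [RHS]mulrC.
have -> : \prod_(w in S) level c j w y = \prod_(w in S) 2^-1.
  by apply: eq_bigr => w /size_S[sw _ _]; rewrite /level sw ltnn.
pose X v l : R := \sum_b trans e (y v) b * lik e c (k - j.+1) (l :: bword v) b.
have -> : \prod_(w | w \notin S) level c j w y =
    Phi y * \prod_(v | size (bword v) == j) \prod_(l | reduced (l :: bword v)) X v l.
  rewrite /Phi [in X in _ = _ * X]big_mkcond [in X in _ = _ * X](bigID (mem S))/=.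
  rewrite [X in _ = _ * (X * _)]big1 ?mul1r -?big_split/=; last first.
    by move=> w /size_S[-> _ _]; rewrite (gtn_eqF (ltnSn j)).
  apply: eq_bigr => w; rewrite inE => wS; rewrite /level.
  have [wj|wj] := leqP (size (bword w)) j; last first.
    rewrite leqNgt ltn_neqAle eq_sym wS wj /= ifN ?mulr1//.
    by rewrite gtn_eqF.
  rewrite (leqW wj) (negPf wS); case: eqP => _; last by rewrite mulr1.
  by rewrite -mulrA; congr (_ * _); rewrite -(subnSK jk).
rewrite big_split/= -mulrA; congr (_ * _); rewrite mulrC; congr (_ * _).
(* Words of length [j + 1] are regrouped by parent, to match the product over letters in [lik]. *)
rewrite (partition_big (@bpar r k) (fun v => size (bword v) == j))/=; last first.
  by move=> w /size_S[_ _ ->].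
apply: eq_bigr => v /eqP sv.
have bK l : reduced (l :: bword v) -> bword (toball k (l :: bword v)) = l :: bword v.
  by move=> rv; rewrite bwordK//= sv.
pose A := [set l : letter r | reduced (l :: bword v)].
pose h l := toball k (l :: bword v).
rewrite (eq_bigl (mem (h @: A))) => [|w]; last first.
  rewrite inE; apply/andP/imsetP => [[]|[l]].
    move=> sw /eqP pw; have := bword_par w; rewrite pw.
    case wE : (bword w) sw => [//|l t]/= _ vE; exists l.
      by rewrite inE vE -wE bword_reduced.
    by rewrite /h vE -wE tobalK.
  rewrite inE => rl ->; split; first by rewrite bK//= sv.
  by apply/eqP/bword_inj; rewrite bword_par bK.
rewrite big_imset/=; last first.
  by move=> l l'; rewrite !inE => rl rl' /(congr1 (@bword r k)); rewrite !bK// => -[].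
apply: eq_big => [l|l]; first by rewrite inE.
rewrite inE => rl; apply: eq_bigr => b _; rewrite /G bK//; congr (_ * _).
have -> : bpar (h l) = v by apply: bword_inj; rewrite bword_par bK.
by rewrite /bweight -bword_eq0 bK// trans_flip.
Qed.

Lemma Ising_ball c : all (fun p => size (val p.1) <= k)%N c ->
  Ising e c = \sum_(y : config | all (fun p => y (toball k (val p.1)) == p.2) c) pmeas e y.
Proof.
move=> ck; rewrite Ising_lik// -level_first.
have lev j : (j <= k)%N ->
    \sum_(y : config) \prod_w level c 0 w y = \sum_(y : config) \prod_w level c j w y.
  by elim: j => [//|j IH] jk; rewrite level_step// IH// ltnW.
rewrite (lev k)// level_last [RHS]big_mkcond/=; apply: eq_bigr => y _.
case: ifP => [/allP H|/negbT/allPn[p pc yp]].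
  rewrite big1 ?mulr1// => w _; rewrite agreeE (_ : all _ c = true)//.
  apply/allP => p pc; apply/implyP => /eqP pw; have := H _ pc.
  by rewrite /= pw tobalK eq_sym.
rewrite (bigD1 (toball k (val p.1)))//= agreeE (_ : all _ c = false) ?mul0r ?mulr0//.
apply/negbTE/allPn; exists p => //.
rewrite bwordK ?(allP ck)//; last by case: (p.1).
by rewrite eqxx /= eq_sym.
Qed.

End IsingBall.

(** * First moment *)

Section Continuity.
Local Open Scope classical_set_scope.
Variables (R : realType).

Lemma continuous_bigsum (T : topologicalType) (I : Type) (s : seq I) (P : pred I) (F : I -> T -> R) :
  (forall i, continuous (F i)) -> continuous (fun x => \sum_(i <- s | P i) F i x).
Proof.
move=> FC; elim: s => [|i s IH].
  by under eq_fun do rewrite big_nil; exact: cst_continuous.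
under eq_fun do rewrite big_cons.
by case: (P i) => // x; apply: cvgD; [exact: FC|exact: IH].
Qed.

Lemma continuous_bigprod (T : topologicalType) (I : Type) (s : seq I) (P : pred I) (F : I -> T -> R) :
  (forall i, continuous (F i)) -> continuous (fun x => \prod_(i <- s | P i) F i x).
Proof.
move=> FC; elim: s => [|i s IH].
  by under eq_fun do rewrite big_nil; exact: cst_continuous.
under eq_fun do rewrite big_cons.
by case: (P i) => // x; apply: cvgM; [exact: FC|exact: IH].
Qed.

Lemma continuous_diff (T : topologicalType) (f g : T -> R) :
  continuous f -> continuous g -> continuous (fun x => f x - g x).
Proof. by move=> cf cg x; apply: cvgB; [exact: cf|exact: cg]. Qed.

Lemma continuous_Ising r (c : cyl r bool) : continuous (fun e : R => Ising e c).
Proof.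
have cl m v a : continuous (fun e : R => lik e c m v a).
  elim: m v a => [|m IH] v a; first exact: (@cst_continuous _ _ (agree R c v a * 1)).
  have ca := @cst_continuous R _ (agree R c v a).
  move=> x; apply: cvgM; first exact: ca.
  apply: continuous_bigprod => l; apply: continuous_bigsum => b {}x.
  apply: cvgM; last exact: IH.
  rewrite /trans; case: (a == b); last exact: cvg_id.
  by apply: cvgB; [exact: cvg_cst|exact: cvg_id].
apply: continuous_bigsum => a x; apply: cvgM; [exact: cvg_cst|exact: cl].
Qed.

Lemma cvg_f_Ising r (e : R) : 0 < e -> e < 1 -> f_Ising r x @[x --> e] --> f_Ising r e.
Proof.
move=> e0 e1; apply: cvgD; first exact: cvg_cst.
apply: cvgM; first exact: cvg_cst.
apply: cvgN; apply: cvgD.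
  have H : (1 - x) @[x --> e] --> 1 - e by apply: cvgB; [exact: cvg_cst|exact: cvg_id].
  apply: cvgM => //; apply: (cvg_comp _ _ H); apply: continuous_ln; lra.
apply: cvgM; first exact: cvg_id.
exact: continuous_ln.
Qed.

(** The finitely many cylinder values and the entropy are continuous in the parameter, so a nearby
    rational serves. *)
Lemma rational_approx r (e d dF : R) (cs : seq (cyl r bool)) : 0 < e -> e < 1 -> 0 < d -> 0 < dF ->
  exists a b : nat, [/\ (0 < a)%N, (a < b)%N,
    forall c, c \in cs -> `|Ising (a%:R / b%:R) c - Ising e c| < d &
    `|f_Ising r (a%:R / b%:R) - f_Ising r e| < dF].
Proof.
move=> e0 e1 d0 dF0.
have N1 : \forall x \near e, forall c, c \in cs -> `|Ising x c - Ising e c| < d.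
  elim: cs => [|c cs IH]; first by near=> x => c; rewrite in_nil.
  have Nc : \forall x \near e, `|Ising e c - Ising x c| < d.
    by have /cvgrPdist_lt/(_ _ d0) := @continuous_Ising r c e.
  near=> x => c'; rewrite inE => /orP[/eqP->|c'cs]; first by rewrite distrC; near: x.
  by apply: (near IH x).
have N2 : \forall x \near e, `|f_Ising r e - f_Ising r x| < dF.
  by have /cvgrPdist_lt/(_ _ dF0) := @cvg_f_Ising r e e0 e1.
have N3 : \forall x \near e, 0 < x < 1.
  by near=> x; apply/andP; split; near: x; [exact: lt_nbhsr|exact: lt_nbhsl].
have [rho /= rho0 H] : nbhs_ball e [set x | [/\ forall c, c \in cs -> `|Ising x c - Ising e c| < d,
    `|f_Ising r e - f_Ising r x| < dF & 0 < x < 1]]%classic.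
  apply/nbhs_ballP; near=> x; split; near: x; [exact: N1|exact: N2|exact: N3].
have [q] := @rat_in_itvoo R e (e + rho) (ltr_pwDr rho0 (lexx e)).
rewrite in_itv/= => /andP[eq qe].
have hq : `|e - ratr q| < rho by rewrite distrC ger0_norm; lra.
have [H1 H2 /andP[q0 q1]] := H (ratr q) hq.
have nq0 : 0 < numq q by rewrite numq_gt0 -(ltr0q R).
have E : ratr q = `|numq q|%N%:R / `|denq q|%N%:R :> R.
  by rewrite /ratr !natr_absz (gtr0_norm nq0) (gtr0_norm (denq_gt0 q)).
exists `|numq q|%N, `|denq q|%N; rewrite -E; split=> //.
- by rewrite absz_gt0 gt_eqF.
- by move: q1; rewrite E ltr_pdivrMr ?mul1r ?ltr_nat// ltr0n absz_gt0 denq_neq0.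
- by rewrite distrC.
Unshelve. all: by end_near. Qed.

End Continuity.

Section FirstMoment.
Variables (R : realType) (r : nat).

Definition actw n (s : hom r n) (w : word r) (v : 'I_n) : 'I_n :=
  foldr (fun (l : letter r) v => if l.2 then ((s l.1)^-1)%g v else s l.1 v) v w.

(** Incompatible pairs have mass 0, so exact pair types make the labels agree along every edge;
    following a word from its last letter then reads each label off the root spins. *)
Lemma typed_hom_consistent k (e : R) n (s : hom r n) (y : {ffun 'I_n -> {ffun wball r k -> bool}}) :
  (forall i yy, (cnt (pairf y (s i)) yy)%:R = n%:R * qmeas e (i, false) yy) ->
  forall w v, y v w = y (actw s (bword w) v) (wball0 r k).
Proof.
move=> yE; have cp v i : compat (i, false) (y v) (y (s i v)).
  apply/negPn/negP => /(qmeas_incompat e) q0; have := yE i (y v, y (s i v)); rewrite q0 mulr0.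
  move=> /eqP; rewrite pnatr_eq0 -leqn0 leqNgt => /negP; apply.
  by apply/card_gt0P; exists v; rewrite inE ffunE.
suff H m w v : size (bword w) = m -> y v w = y (actw s (bword w) v) (wball0 r k).
  by move=> w v; exact: H.
elim: m w v => [|m IH] w v sw.
  have w0 : w = wball0 r k by apply/eqP; rewrite -bword_eq0 -size_eq0 sw.
  by rewrite w0.
have := bword_reduced w; have := bword_size w; move: sw; case/lastP wE : (bword w) => [//|t l].
rewrite size_rcons => -[st] tk; rewrite reduced_rcons => /andP[rt lt].
have tE : bword (toball k t) = t by rewrite bwordK// st; move: tk; rewrite st; exact: ltnW.
have wE' : w = toball k (rcons t l) by rewrite -wE tobalK.
rewrite /actw foldr_rcons -/(actw s t _) -[in RHS]tE.
case: l => i [] in wE lt wE' *; rewrite /= -IH ?tE//.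
  (* An inverse generator is the edge into [v] read backwards. *)
  have /compatP H := cp ((s i)^-1%g v) i; rewrite permKV in H.
  rewrite H; first by rewrite /brmul wE (rmul_rcons (i, false)).
  by rewrite inE wE (rmul_rcons (i, false)) ltnW.
have /compatP H := cp v i; rewrite H; first by rewrite /brmul tE rmul_last// wE'.
by rewrite inE tE rmul_last// size_rcons.
Qed.

(** By consistency the label of [v] shows all spins within distance [k], so the vertex type alone
    fixes every such cylinder frequency exactly. *)
Lemma emp_typed k (e : R) n (s : hom r n) (y : {ffun 'I_n -> {ffun wball r k -> bool}}) c :
  (0 < n)%N ->
  (forall z, (cnt y z)%:R = n%:R * pmeas e z) ->
  (forall w v, y v w = y (actw s (bword w) v) (wball0 r k)) ->
  all (fun p => size (val p.1) <= k)%N c ->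
  emp R s [ffun v => y v (wball0 r k)] c = Ising e c.
Proof.
move=> n0 yp yc ck; rewrite (@Ising_ball R r k)//.
have nR : n%:R != 0 :> R by rewrite pnatr_eq0 -lt0n.
apply: (mulfI nR); rewrite mulr_sumr; under [RHS]eq_bigr do rewrite -yp.
rewrite /emp mulrC divfK// -natr_sum; congr _%:R.
rewrite -sum1_card (partition_big (fun v => y v)
  (fun z : {ffun wball r k -> bool} => all (fun p => z (toball k (val p.1)) == p.2) c))/=; last first.
  move=> v; rewrite inE => /allP H; apply/allP => p pc.
  have := H p pc; rewrite ffunE (yc (toball k (val p.1))) bwordK ?(allP ck)//; by case: (p.1).
apply: eq_bigr => z /allP zc; rewrite sum1dep_card; apply: eq_card => v; rewrite !inE.
apply: andb_idl => /eqP yz; apply/allP => p pc; have := zc p pc.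
rewrite -yz ffunE (yc (toball k (val p.1))) bwordK ?(allP ck)//.
by case: (p.1).
Qed.

(** Labellings inject into colourings through their root spins. Exact balance survives the change of
    parameter because every Ising measure is uniform at a vertex. *)
Lemma first_moment (eps : R) (cs : seq (cyl r bool)) (d delta : R) (n0 : nat) :
  (0 < r)%N -> 0 < eps -> eps < 1 -> 0 < d -> 0 < delta ->
  exists n, [/\ (n0 <= n)%N, (0 < n)%N &
    expR (n%:R * (f_Ising r eps - delta)) <=
    (\sum_(s : hom r n) #|[set x : {ffun 'I_n -> bool} |
       (emp R s x [:: (FG1, true)] == 2^-1) && in_nbhd (Ising eps) cs d s x]|)%:R
      / #|{: hom r n}|%:R].
Proof.
move=> r0 eps0 eps1 d0 delta0.
have [a [b [a0 ab Icl Fcl]]] := rational_approx cs eps0 eps1 d0 (divr_gt0 delta0 (ltr0Sn R 1)).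
set e := a%:R / b%:R in Icl Fcl.
have b0 : (0 < b)%N by exact: leq_ltn_trans ab.
have e0 : 0 < e by rewrite divr_gt0 ?ltr0n.
have e1 : e < 1 by rewrite ltr_pdivrMr ?ltr0n// mul1r ltr_nat.
pose k := (\max_(c <- cs) \max_(p <- c) size (val p.1)).+1.
have ck c : c \in cs -> all (fun p => size (val p.1) <= k)%N c.
  move=> ccs; apply/allP => p pc; apply: leqW.
  have H1 : (size (val p.1) <= \max_(p <- c) size (val p.1))%N by exact: leq_bigmax_seq.
  by apply: (leq_trans H1); exact: (@leq_bigmax_seq _ cs xpredT (fun c => \max_(p <- c) size (val p.1)) c).
have [D D0 [[N0 N0E] [N NE]]] := @qmeas_integral R r k e a b b0 (ltnW ab) erefl.
have k0 : (0 < k)%N by [].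
have [m [nm m0 H]] := @typed_hom_rate R r _ (pmeas e) (fun i => qmeas e (i, false)) D N0
  (fun i => N (i, false)) (delta / 2) n0 D0 (@pmeas_sum R r k e)
  (fun i y => @qmeas_row R r k e (i, false) y) (fun i y => @qmeas_col R r k e k0 (i, false) y e0 e1) N0E
  (fun i => NE (i, false)) (divr_gt0 delta0 (ltr0Sn R 1)).
exists (D * m)%N; split=> //; first by rewrite muln_gt0 D0.
have nR : 0 < (D * m)%:R :> R by rewrite ltr0n muln_gt0 D0.
apply: le_trans (le_trans H _).
  rewrite ler_expR ler_pM2l// (ball_entropy k e0 e1 r0).
  by move: Fcl; rewrite ltr_distl; lra.
rewrite ler_wpM2r ?invr_ge0 ?ler0n// ler_nat; apply: leq_sum => s _.
set ty := typed_hom _ _ s.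
pose h (y : {ffun 'I_(D * m) -> {ffun wball r k -> bool}}) : {ffun 'I_(D * m) -> bool} :=
  [ffun v => y v (wball0 r k)].
have tyP y : y \in ty -> (forall z, (cnt y z)%:R = (D * m)%:R * pmeas e z) /\
    (forall w v, y v w = y (actw s (bword w) v) (wball0 r k)).
  rewrite !inE => /andP[/forallP y1 /forallP y2]; split.
    by move=> z; rewrite (eqP (y1 z)) !natrM N0E; ring.
  apply: (@typed_hom_consistent k e) => i yy; have := y2 i; rewrite inE => /forallP/(_ yy)/eqP->.
  by rewrite !natrM NE; ring.
rewrite -(card_in_imset (f := h)); last first.
  move=> y y' /tyP[_ yc] /tyP[_ yc'] hh; apply/ffunP => v; apply/ffunP => w.
  rewrite yc yc'; have := congr1 (fun x : {ffun 'I_(D * m) -> bool} => x (actw s (bword w) v)) hh.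
  by rewrite !ffunE.
apply/subset_leq_card/fintype.subsetP => _ /imsetP[y /tyP[y1 y2] ->]; rewrite inE.
rewrite (emp_typed _ y1 y2) ?muln_gt0 ?D0//; first rewrite Ising_vertex eqxx /=.
apply/allP => c ccs; rewrite (emp_typed _ y1 y2) ?muln_gt0 ?D0//; last exact: ck.
exact: Icl.
Qed.

End FirstMoment.

(** * Limit points of the second moment *)

Section Actions.
Variables (r n : nat) (s : hom r n).

Definition actl (l : letter r) (v : 'I_n) : 'I_n := if l.2 then ((s l.1)^-1)%g v else s l.1 v.

Lemma actw_lmul l w v : actw s (lmul l w) v = actl l (actw s w v).
Proof.
case: w => [|l' w]//=; case: ifP => //; rewrite /cancels => /andP[/eqP E1 E2].
rewrite /actl E1; case: l.2 l'.2 E2 => -[]//= _; first by rewrite permK.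
by rewrite permKV.
Qed.

Lemma actw_red w v : actw s (red w) v = actw s w v.
Proof. by elim: w => [|l w IH]//=; rewrite actw_lmul IH. Qed.

Lemma act_mul (g h : FG r) v : act s (FGmul g h) v = act s g (act s h v).
Proof. by rewrite -[LHS]/(actw s (red _) v) actw_red /actw foldr_cat. Qed.

Lemma act_inj (g : FG r) : injective (act s g).
Proof.
rewrite /act; elim: (val g) => [|l w IH]//= u v; case: l.2 => /perm_inj; exact: IH.
Qed.

End Actions.

Section EmpiricalIdentities.
Variables (R : realType) (r n : nat) (s : hom r n) (A : finType) (x : {ffun 'I_n -> A}).

Lemma sum_card_fiber (I J : finType) (P : pred I) (f : I -> J) :
  (\sum_b #|[set v | P v && (f v == b)]| = #|[set v | P v]|)%N.
Proof.
rewrite -[RHS]sum1_card (partition_big f xpredT)//=; apply: eq_bigr => b _.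
by rewrite sum1dep_card; apply: eq_card => v; rewrite !inE.
Qed.

Lemma emp_ge0 c : 0 <= emp R s x c.
Proof. by rewrite divr_ge0 ?ler0n. Qed.

Lemma emp_le1 c : emp R s x c <= 1.
Proof.
rewrite /emp; have [n0|n0] := posnP n; first by rewrite [X in _ / X%:R]n0 invr0 mulr0.
rewrite ler_pdivrMr ?ltr0n// mul1r ler_nat -[leqRHS](card_ord n); exact: max_card.
Qed.

Lemma emp_nil : (0 < n)%N -> emp R s x [::] = 1.
Proof.
move=> n0; rewrite /emp (_ : #|_| = n) ?divff ?pnatr_eq0 -?lt0n//.
by rewrite -[RHS](card_ord n); apply: eq_card => v; rewrite !inE.
Qed.

Lemma emp_cons c g : emp R s x c = \sum_a emp R s x ((g, a) :: c).
Proof.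
rewrite /emp -mulr_suml -natr_sum; congr (_%:R / _).
rewrite -(sum_card_fiber _ (fun v => x (act s g v))); apply: eq_bigr => a _.
by apply: eq_card => v; rewrite !inE /= andbC.
Qed.

Lemma emp_eqi c1 c2 : c1 =i c2 -> emp R s x c1 = emp R s x c2.
Proof.
by move=> c12; congr (_%:R / _); apply: eq_card => v; rewrite !inE (eq_all_r c12).
Qed.

Lemma emp_shift (beta : FG r) c : emp R s x [seq (FGmul p.1 beta, p.2) | p <- c] = emp R s x c.
Proof.
congr (_%:R / _); rewrite -[RHS](card_preimset _ (@act_inj _ _ s beta)).
apply: eq_card => v; rewrite !inE all_map; apply: eq_all => p /=.
by rewrite act_mul.
Qed.

End EmpiricalIdentities.

Section Marginals.
Variables (R : realType) (r n : nat) (s : hom r n) (z : {ffun 'I_n -> bool * bool}).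

Definition proj1f : {ffun 'I_n -> bool} := [ffun v => (z v).1].
Definition proj2f : {ffun 'I_n -> bool} := [ffun v => (z v).2].

Lemma marg1_emp c : marg1 (emp R s z) c = emp R s proj1f c.
Proof.
suff H acc : marg1_aux (emp R s z) c acc =
  #|[set v | all (fun p => (z (act s p.1 v)).1 == p.2) c && all (fun p => z (act s p.1 v) == p.2) acc]|%:R / n%:R.
  rewrite /marg1 H; congr (_%:R / _); apply: eq_card => v; rewrite !inE andbT.
  by apply: eq_all => p; rewrite ffunE.
elim: c acc => [|p c IH] acc /=; first by congr (_%:R / _); apply: eq_card => v; rewrite !inE.
under eq_bigr do rewrite IH; rewrite -mulr_suml -natr_sum; congr (_%:R / _).
rewrite -[RHS](sum_card_fiber _ (fun v => (z (act s p.1 v)).2)); apply: eq_bigr => b _.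
apply: eq_card => v; rewrite !inE /=; case: (z _) => z1 z2; rewrite xpair_eqE /=.
by case: (z1 == _); case: (z2 == _); rewrite /= ?andbF ?andbT.
Qed.

Lemma marg2_emp c : marg2 (emp R s z) c = emp R s proj2f c.
Proof.
suff H acc : marg2_aux (emp R s z) c acc =
  #|[set v | all (fun p => (z (act s p.1 v)).2 == p.2) c && all (fun p => z (act s p.1 v) == p.2) acc]|%:R / n%:R.
  rewrite /marg2 H; congr (_%:R / _); apply: eq_card => v; rewrite !inE andbT.
  by apply: eq_all => p; rewrite ffunE.
elim: c acc => [|p c IH] acc /=; first by congr (_%:R / _); apply: eq_card => v; rewrite !inE.
under eq_bigr do rewrite IH; rewrite -mulr_suml -natr_sum; congr (_%:R / _).
rewrite -[RHS](sum_card_fiber _ (fun v => (z (act s p.1 v)).1)); apply: eq_bigr => b _.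
apply: eq_card => v; rewrite !inE /=; case: (z _) => z1 z2; rewrite xpair_eqE /=.
by case: (z1 == _); case: (z2 == _); rewrite /= ?andbF ?andbT.
Qed.

End Marginals.

Section Compactness.
Variables (R : realType) (r : nat) (eps L : R).
Local Notation mu := (@Ising R r eps).
Local Notation cyl2 := (cyl r (bool * bool)%type).

(** Exact balance makes the colouring a bisection, so that its cut bounds [mcut]. *)
Definition good (cs : seq (cyl r bool)) (d : R) n (s : hom r n) (x : {ffun 'I_n -> bool}) : bool :=
  (emp R s x [:: (FG1, true)] == 2^-1) && in_nbhd mu cs d s x.

Definition good2 cs d n (s : hom r n) (z : {ffun 'I_n -> bool * bool}) : bool :=
  good cs d s (proj1f z) && good cs d s (proj2f z).

Definition mass cs d n (S : set (cyl2 -> R)) : R :=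
  (\sum_(s : hom r n) #|[set z | good2 cs d s z && `[< S (emp R s z) >]]|)%:R / #|{: hom r n}|%:R.

(* Sets of empirical measures whose contribution to the second moment is
   exponentially smaller than [exp (n L)]. *)
Definition small (S : set (cyl2 -> R)) : Prop :=
  exists cs d delta N, [/\ 0 < d, 0 < delta &
    forall n, (N <= n)%N -> mass cs d n S <= expR (n%:R * (L - delta))].

Lemma good_mono cs cs' d d' n (s : hom r n) x : {subset cs <= cs'} -> d' <= d ->
  good cs' d' s x -> good cs d s x.
Proof.
move=> sub dd /andP[b /allP H]; apply/andP; split=> //; apply/allP => c /sub /H Hc.
exact: lt_le_trans Hc dd.
Qed.

Lemma mass_mono cs cs' d d' n (S S' : set (cyl2 -> R)) : {subset cs <= cs'} -> d' <= d ->
  (forall m, S' m -> S m) -> mass cs' d' n S' <= mass cs d n S.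
Proof.
move=> sub dd SS; rewrite ler_wpM2r ?invr_ge0 ?ler0n// ler_nat; apply: leq_sum => s _.
apply/subset_leq_card/fintype.subsetP => z; rewrite !inE => /andP[/andP[g1 g2] /asboolP Sz].
by rewrite /good2 !(good_mono sub dd)//=; apply/asboolP; exact: SS.
Qed.

Lemma small_sub (S S' : set (cyl2 -> R)) : (forall m, S' m -> S m) -> small S -> small S'.
Proof.
move=> SS [cs [d [delta [N [d0 delta0 H]]]]]; exists cs, d, delta, N; split=> // n Nn.
by apply: le_trans (H n Nn); exact: mass_mono.
Qed.

Lemma small_setU (S S' : set (cyl2 -> R)) : small S -> small S' -> small (S `|` S')%classic.
Proof.
move=> [cs [d [delta [N [d0 delta0 H]]]]] [cs' [d' [delta' [N' [d'0 delta'0 H']]]]].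
(* The other half of the smaller exponent absorbs the factor 2 for large [n]. *)
pose D := Num.min delta delta' / 2.
have D0 : 0 < D by rewrite divr_gt0// lt_min delta0.
exists (cs ++ cs'), (Num.min d d'), D, (maxn (maxn N N') (Num.truncn (ln 2 / D)).+1).
split=> //; first by rewrite lt_min d0.
move=> n; rewrite !geq_max => /andP[/andP[Nn N'n] nD].
apply: (@le_trans _ _ (mass cs d n S + mass cs' d' n S')).
  apply: (@le_trans _ _ (mass (cs ++ cs') (Num.min d d') n S + mass (cs ++ cs') (Num.min d d') n S')).
    rewrite /mass -mulrDl -natrD -big_split/= ler_wpM2r ?invr_ge0 ?ler0n// ler_nat.
    apply: leq_sum => s _; apply: leq_trans (leq_card_setU _ _).
    apply/subset_leq_card/fintype.subsetP => z; rewrite !inE => /andP[-> /asboolP[?|?]]/=.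
      by rewrite asboolT.
    by rewrite [X in _ || X]asboolT ?orbT.
  by apply: lerD; apply: mass_mono => // [c cc|];
    rewrite ?mem_cat ?cc ?orbT// ge_min lexx ?orbT.
have n2 : 2 <= expR (n%:R * D) :> R.
  rewrite -[leLHS]lnK ?posrE// ler_expR -ler_pdivrMr//.
  by apply: ltW; apply: lt_le_trans (truncnS_gt _) _; rewrite ler_nat.
have b1 : expR (n%:R * (L - delta)) <= expR (n%:R * (L - D - D)).
  rewrite ler_expR ler_wpM2l ?ler0n//.
  have : Num.min delta delta' <= delta by rewrite ge_min lexx.
  by rewrite /D; lra.
have b2 : expR (n%:R * (L - delta')) <= expR (n%:R * (L - D - D)).
  rewrite ler_expR ler_wpM2l ?ler0n//.
  have : Num.min delta delta' <= delta' by rewrite ge_min lexx orbT.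
  by rewrite /D; lra.
apply: (@le_trans _ _ (2 * expR (n%:R * (L - D - D)))).
  by rewrite mulr_natl mulr2n lerD// ?(le_trans (H _ _))// (le_trans (H' _ _)).
have -> : n%:R * (L - D) = n%:R * D + n%:R * (L - D - D) by ring.
by rewrite expRD ler_pM2r ?expR_gt0.
Qed.

Lemma small_empty (S : set (cyl2 -> R)) :
  (forall n (s : hom r n) (z : {ffun 'I_n -> bool * bool}), ~ S (emp R s z)) -> small S.
Proof.
move=> S0; exists [::], 1, 1, 0%N; split=> // n _.
rewrite /mass big1 ?mul0r ?expR_ge0// => s _; apply: eq_card0 => z.
by rewrite inE (asboolF (S0 _ _ _)) andbF.
Qed.

End Compactness.

Section LimitPoint.
Variables (R : realType) (r : nat) (eps L : R).
Local Notation mu := (@Ising R r eps).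
Local Notation cyl2 := (cyl r (bool * bool)%type).
Local Notation small := (@small R r eps L).
Local Open Scope classical_set_scope.
Import ArrowAsProduct.

Hypothesis not_small : ~ small setT.

(** The filter dual to the ideal of small sets; it is proper exactly because the whole space is not
    small. *)
Definition cosmall : set_system (cyl2 -> R) := [set S | small (~` S)].

Lemma cosmall_filter : ProperFilter cosmall.
Proof.
split; first by rewrite /cosmall/= setC0.
split.
- by rewrite /cosmall/= setCT; apply: small_empty => n s z [].
- by move=> S S' FS FS'; rewrite /cosmall/= setCI; exact: small_setU.
- by move=> S S' SS'; apply: small_sub => m; apply: contra_not; exact: SS'.
Qed.

(** The cube of functions into [0, 1] is compact by Tychonoff. A small neighbourhood of a cluster
    point would have its complement in the filter and would then have to meet it. *)
Lemma exists_limit_point : exists lam : cyl2 -> R,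
  (forall c, 0 <= lam c) /\ forall U, nbhs lam U -> ~ small U.
Proof.
have PF := cosmall_filter.
pose K := [set f : cyl2 -> R | forall c, `[0, 1]%classic (f c)].
have cK : compact K := @tychonoff _ (fun=> R) (fun=> `[0, 1]%classic) (fun=> @segment_compact R 0 1).
have FK : cosmall K.
  apply: small_empty => n s z; apply=> c /=.
  by rewrite in_itv/= emp_ge0 emp_le1.
have [lam [Klam clam]] := cK _ PF FK.
exists lam; split=> [c|U Ulam sU]; first by have := Klam c; rewrite /= in_itv/= => /andP[].
have FU : cosmall (~` U) by rewrite /cosmall/= setCK.
by have [m []] := clam _ _ FU Ulam.
Qed.

Variable lam : cyl2 -> R.
Hypotheses (lam0 : forall c, 0 <= lam c) (lamU : forall U, nbhs lam U -> ~ small U).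

Lemma limit_frequently U cs d delta N : nbhs lam U -> 0 < d -> 0 < delta ->
  exists2 n, (N <= n)%N & expR (n%:R * (L - delta)) < mass eps cs d n U.
Proof.
move=> nU d0 delta0; apply: contrapT => H; apply: (lamU nU).
exists cs, d, delta, N; split=> // n Nn; rewrite leNgt; apply/negP => h.
by apply: H; exists n.
Qed.

(** Every neighbourhood of [lam] contains the empirical measure of some good pair, for any precision
    required of [good2]; closed conditions thus pass to [lam]. *)
Lemma limit_zero (phi : (cyl2 -> R) -> R) : continuous phi ->
  (forall e : R, 0 < e -> exists cs d, 0 < d /\
     forall n (s : hom r n) (z : {ffun 'I_n -> bool * bool}), (0 < n)%N ->
     good2 eps cs d s z -> `|phi (emp R s z)| < e) ->
  phi lam = 0.
Proof.
move=> cphi H; apply/eqP; rewrite -normr_le0; apply/ler_addgt0Pr => e e0; rewrite add0r.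
have e20 : 0 < e / 2 by rewrite divr_gt0.
have [cs [d [d0 Hphi]]] := H _ e20.
have nU : nbhs lam [set m | `|phi lam - phi m| < e / 2].
  by have /cvgrPdist_lt/(_ _ e20) := cphi lam.
have [n n0 Hn] := limit_frequently cs 1 nU d0 ltr01.
have {Hn} : 0 < mass eps cs d n [set m | `|phi lam - phi m| < e / 2].
  by apply: lt_trans Hn; exact: expR_gt0.
rewrite /mass lt_neqAle eq_sym mulf_eq0 negb_or => /andP[/andP[+ _] _].
rewrite pnatr_eq0 sum_nat_eq0 negb_forall => /existsP[s].
rewrite negb_imply/= -lt0n => /card_gt0P[z]; rewrite inE => /andP[gz /asboolP/= hz].
have := Hphi n s z n0 gz; move: hz; set x := phi lam; set y := phi _ => h1 h2.
rewrite -(subrK y x) (le_trans (ler_normD _ _))//; lra.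
Qed.

Lemma limit_eq0 (phi : (cyl2 -> R) -> R) : continuous phi ->
  (forall n (s : hom r n) (z : {ffun 'I_n -> bool * bool}), (0 < n)%N -> phi (emp R s z) = 0) ->
  phi lam = 0.
Proof.
move=> cphi H; apply: limit_zero => // e e0; exists [::], 1; split=> // n s z n0 _.
by rewrite H// normr0.
Qed.

Lemma continuous_coord (c : cyl2) : continuous (fun m : cyl2 -> R => m c).
Proof. exact: (@proj_continuous _ (fun _ : cyl2 => R) c). Qed.

Lemma limit_prob_meas : is_prob_meas lam.
Proof.
split=> //.
- apply/eqP; rewrite -subr_eq0; apply/eqP.
  apply: (limit_eq0 (phi := fun m => m [::] - 1)).
    by apply: (continuous_diff (f := fun m => m [::]) (g := fun=> 1));
      [exact: continuous_coord|exact: cst_continuous].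
  by move=> n s z n0; rewrite emp_nil// subrr.
- move=> c g; apply/eqP; rewrite -subr_eq0; apply/eqP.
  apply: (limit_eq0 (phi := fun m => m c - \sum_a m ((g, a) :: c))).
    apply: (continuous_diff (f := fun m : cyl2 -> R => m c) (g := fun m : cyl2 -> R => \sum_a m ((g, a) :: c))).
      exact: continuous_coord.
    by apply: continuous_bigsum => a; exact: continuous_coord.
  by move=> n s z n0; rewrite (emp_cons _ _ _ _ g) subrr.
- move=> c1 c2 c12; apply/eqP; rewrite -subr_eq0; apply/eqP.
  apply: (limit_eq0 (phi := fun m => m c1 - m c2)).
    by apply: (continuous_diff (f := fun m : cyl2 -> R => m c1) (g := fun m : cyl2 -> R => m c2));
      exact: continuous_coord.
  by move=> n s z n0; rewrite (emp_eqi _ _ _ c12) subrr.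
Qed.

Lemma limit_shift : shift_invariant lam.
Proof.
move=> beta c; apply/eqP; rewrite -subr_eq0; apply/eqP.
apply: (limit_eq0 (phi := fun m => m [seq (FGmul p.1 beta, p.2) | p <- c] - m c)).
  apply: (continuous_diff (f := fun m : cyl2 -> R => m [seq (FGmul p.1 beta, p.2) | p <- c])
    (g := fun m : cyl2 -> R => m c));
    exact: continuous_coord.
by move=> n s z n0; rewrite emp_shift subrr.
Qed.

Lemma limit_marg1 c : marg1 lam c = mu c.
Proof.
apply/eqP; rewrite -subr_eq0; apply/eqP.
apply: (limit_zero (phi := fun m => marg1 m c - mu c)).
  apply: (continuous_diff (f := fun m : cyl2 -> R => marg1 m c) (g := fun=> mu c)); last exact: cst_continuous.
  rewrite /marg1; elim: c [::] => [|p c IH] acc /=; first exact: continuous_coord.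
  by apply: continuous_bigsum => b; exact: IH.
move=> e e0; exists [:: c], e; split=> // n s z n0 /andP[/andP[_ H] _].
by move: H; rewrite /in_nbhd/= andbT marg1_emp.
Qed.

Lemma limit_marg2 c : marg2 lam c = mu c.
Proof.
apply/eqP; rewrite -subr_eq0; apply/eqP.
apply: (limit_zero (phi := fun m => marg2 m c - mu c)).
  apply: (continuous_diff (f := fun m : cyl2 -> R => marg2 m c) (g := fun=> mu c)); last exact: cst_continuous.
  rewrite /marg2; elim: c [::] => [|p c IH] acc /=; first exact: continuous_coord.
  by apply: continuous_bigsum => b; exact: IH.
move=> e e0; exists [:: c], e; split=> // n s z n0 /andP[_ /andP[_ H]].
by move: H; rewrite /in_nbhd/= andbT marg2_emp.
Qed.

Lemma limit_joining : joining lam mu mu.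
Proof. by split; [exact: limit_prob_meas|exact: limit_shift|exact: limit_marg1|exact: limit_marg2]. Qed.

(** For each neighbourhood of [lam], its share of the second moment has rate at least [L] along
    infinitely many [n], and dropping goodness only adds colourings. *)
Lemma limit_f_inv : (L%:E <= f_inv lam)%E.
Proof.
apply: le_ereal_inf_tmp => _ [cs _ [d /= d0 <-]].
apply/lee_subgt0Pr => delta delta0; rewrite -EFinB.
have nU : nbhs lam [set m | all (fun c => `|m c - lam c| < d) cs].
  elim: cs => [|c cs IH]; first by apply: filterS filterT.
  have Nc : nbhs lam [set m : cyl2 -> R | `|lam c - m c| < d].
    by have /cvgrPdist_lt/(_ _ d0) := @continuous_coord c lam.
  by apply: filterS (filterI IH Nc) => m /= [-> h]; rewrite distrC h.
apply: limn_esup_ge_frequently => N.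
have [n Nn Hn] := limit_frequently [::] N.+1 nU ltr01 delta0.
exists n; first exact: ltnW.
have n0 : (0 < n)%N by exact: leq_ltn_trans Nn.
have le : mass eps [::] 1 n [set m | all (fun c => `|m c - lam c| < d) cs] <= expOmega lam cs d n.
  rewrite ler_wpM2r ?invr_ge0 ?ler0n// ler_nat; apply: leq_sum => s _.
  apply/subset_leq_card/fintype.subsetP => z; rewrite !inE => /andP[_ /asboolP]; exact.
have E0 : expR (n%:R * (L - delta)) < expOmega lam cs d n by exact: lt_le_trans le.
have Ep : 0 < expOmega lam cs d n by apply: lt_trans E0; exact: expR_gt0.
rewrite /rate gt_eqF// lee_fin ler_pdivlMr ?ltr0n// mulrC.
by rewrite -ler_expR lnK ?posrE// ltW.
Qed.

End LimitPoint.

(** * Conclusion *)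

Section McutBounds.
Variables (R : realType) (r : nat).

Lemma mcut_le_edges n (s : hom r n) : (mcut s <= r * n)%N.
Proof. by rewrite /mcut; elim/big_rec: _ => // V m _ H; rewrite geq_min H orbT. Qed.

Lemma mcut_le_cut n (s : hom r n) (V : {set 'I_n}) : is_bisection V -> (mcut s <= cut_size s V)%N.
Proof.
move=> bV; rewrite /mcut; have := mem_index_enum V.
elim: (index_enum _) => [//|W l IH]; rewrite inE big_cons => /orP[/eqP<-|/IH H].
  by rewrite bV geq_minl.
by case: ifP => // _; rewrite geq_min H orbT.
Qed.

(** Otherwise every [s] would deviate by more than half the gap, an event of probability 1 rather
    than at most 1/2. *)
Lemma eps_c_le (ec B : R) : is_eps_c r ec ->
  (forall n (s : hom r n), (0 < n)%N -> (mcut s)%:R / (r * n)%:R <= B) -> ec <= B.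
Proof.
move=> Hec HB; rewrite leNgt; apply/negP => Bec.
have eta0 : 0 < (ec - B) / 2 by rewrite divr_gt0// subr_gt0.
have [N HN] := Hec _ (2^-1) eta0 (ltac:(by rewrite invr_gt0)).
have := HN N.+1 (leqnSn N); rewrite (_ : [set s | _] = [set: hom r N.+1]); last first.
  apply/setP => s; rewrite !inE distrC; apply: lt_le_trans (ler_norm _).
  by have := HB _ s (ltn0Sn N); move: Bec; set t := _ / _; lra.
rewrite cardsT divff ?gt_eqF ?card_hom_gt0//; lra.
Qed.

(** Each generator has two kinds of cut edges, each of frequency within [d] of [eps / 2]. *)
Lemma good_mcut_le (eps : R) cs d n (s : hom r n) x : (0 < n)%N ->
  {subset edge_cyls r bool <= cs} -> good eps cs d s x ->
  (mcut s)%:R <= (r * n)%:R * (eps + 2 * d).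
Proof.
move=> n0 sub /andP[/eqP bal /allP H]; have nR : 0 < n%:R :> R by rewrite ltr0n.
pose V := [set v | x v].
have cV : (#|V| * 2 = n)%N.
  apply/eqP; rewrite -(eqr_nat R) natrM; apply/eqP.
  have cV : cnt x true = #|V| by apply: eq_card => v; rewrite !inE eqb_id.
  move: bal; rewrite emp_vertex cV => bal.
  by rewrite -(divfK (lt0r_neq0 nR) #|V|%:R) bal; lra.
have bV : is_bisection V by rewrite /is_bisection; move: #|V| cV => m mn; apply/andP; split; lia.
apply: (@le_trans _ _ (cut_size s V)%:R); first by rewrite ler_nat mcut_le_cut.
have -> : cut_size s V = (\sum_(i < r) (cnt (pairf x (s i)) (true, false) + cnt (pairf x (s i)) (false, true)))%N.
  rewrite /cut_size -sum1_card (partition_big (fun p : 'I_n * 'I_r => p.2) xpredT)//=.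
  apply: eq_bigr => i _; rewrite !cntE -big_split/=.
  rewrite (reindex_onto (fun v => (v, i)) fst)/=; last by move=> [v j] /andP[_ /eqP /= ->].
  rewrite big_mkcond/=; apply: eq_bigr => v _; rewrite !inE/= !eqxx !andbT !ffunE !xpair_eqE.
  by case: (x v); case: (x (s i v)).
rewrite natr_sum natrM -mulrA mulr_natl -[X in _ <= _ *+ X]card_ord -sumr_const; apply: ler_sum => i _.
have e1 := H _ (sub _ (edge_cyls_edge i true false)).
have e2 := H _ (sub _ (edge_cyls_edge i false true)).
rewrite emp_edge Ising_edge /trans/= ltr_distl in e1.
rewrite emp_edge Ising_edge /trans/= ltr_distl in e2.
case/andP: e1 => _; case/andP: e2 => _; rewrite !ltr_pdivrMr// natrD; lra.
Qed.

Lemma card_good2_ge (eps : R) cs d n (s : hom r n) :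
  (#|[set x | good eps cs d s x]| ^ 2 <=
   #|[set z | good2 eps cs d s z && `[< @setT (cyl r (bool * bool)%type -> R) (emp R s z) >]]|)%N.
Proof.
rewrite -mulnn -cardsX.
pose h (p : {ffun 'I_n -> bool} * {ffun 'I_n -> bool}) : {ffun 'I_n -> bool * bool} :=
  [ffun v => (p.1 v, p.2 v)].
have h1 p : proj1f (h p) = p.1 by apply/ffunP => v; rewrite !ffunE.
have h2 p : proj2f (h p) = p.2 by apply/ffunP => v; rewrite !ffunE.
have hI : injective h by move=> p q E; rewrite [p]surjective_pairing -h1 -h2 E h1 h2 -surjective_pairing.
rewrite -(card_imset _ hI); apply/subset_leq_card/fintype.subsetP => _ /imsetP[p + ->].
rewrite !inE => /andP[g1 g2]; rewrite /good2 h1 h2 g1 g2 /=.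
exact/asboolP.
Qed.

End McutBounds.

Section SecondMoment.
Variables (R : realType) (r : nat) (ec eps : R).
Hypotheses (r0 : (0 < r)%N) (Hec : is_eps_c r ec) (eps0 : 0 < eps) (epsc : eps < ec) (eps1 : eps < 1).

(** Since E Z^2 >= (E Z)^2 / P(Z > 0), the rate would in fact be close to 2F + c; claiming only c/2
    leaves slack. *)
Lemma second_moment_not_small : exists2 c : R, 0 < c &
  ~ small eps (2 * f_Ising r eps + c / 2) (@setT (cyl r (bool * bool)%type -> R)).
Proof.
set F := f_Ising r eps.
have eta0 : 0 < (ec - eps) / 2 by rewrite divr_gt0// subr_gt0.
have [c c0 [N0 HN0]] := mcut_tail r0 Hec eta0.
exists c => // -[cs [d [delta [N [d0 delta0 HN]]]]].
(* With this radius [eps + 2 * d1] is at most the midpoint of [eps] and [ec], the threshold of the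
   tail bound. *)
pose d1 := Num.min d ((ec - eps) / 4).
have d10 : 0 < d1 by rewrite lt_min d0 divr_gt0// subr_gt0.
pose cs1 := cs ++ edge_cyls r bool.
have m0 : 0 < Num.min delta (c / 2) by rewrite lt_min delta0 divr_gt0.
have [n [nn n0 H1]] := first_moment cs1 (maxn N N0) r0 eps0 eps1 d10 (divr_gt0 m0 (ltr0Sn R 1)).
move: nn; rewrite geq_max => /andP[Nn N0n].
have nR : 0 < n%:R :> R by rewrite ltr0n.
pose Z (s : hom r n) : nat := #|[set x | good eps cs1 d1 s x]|.
have EZ : expR (n%:R * (F - Num.min delta (c / 2) / 2)) <= mean (fun s : hom r n => (Z s)%:R : R).
  by rewrite /mean -natr_sum.
have EZ2 : mean (fun s : hom r n => (Z s)%:R ^+ 2 : R) <= expR (n%:R * (2 * F + c / 2 - delta)).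
  apply: le_trans (HN n Nn).
  have : mass eps cs1 d1 n (@setT (cyl r (bool * bool)%type -> R)) <= mass eps cs d n setT.
    by apply: mass_mono => // [? h|]; rewrite ?mem_cat ?h// ge_min lexx.
  apply: le_trans; rewrite /mean /mass ler_wpM2r ?invr_ge0 ?ler0n// natr_sum.
  by apply: ler_sum => s _; rewrite -natrX ler_nat card_good2_ge.
have PZ : mean (fun s : hom r n => (0 < Z s)%N%:R : R) <= expR (- (c * n%:R)).
  apply: le_trans (HN0 n N0n); apply: ler_mean => s.
  have [_|/card_gt0P[x]] := posnP (Z s); first by rewrite ler_nat.
  rewrite inE => gx.
  have sub : {subset edge_cyls r bool <= cs1} by move=> cc h; rewrite mem_cat h orbT.
  have := good_mcut_le n0 sub gx.
  have : d1 <= (ec - eps) / 4 by rewrite ge_min lexx orbT.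
  move=> dd hm; have -> : ((mcut s)%:R <= (r * n)%:R * (ec - (ec - eps) / 2))%R by
    apply: (le_trans hm); rewrite ler_wpM2l ?ler0n//; lra.
  by [].
(* This weight bounds the two terms below by exp(n(F - delta)) and exp(n(F - c/2)). *)
pose al := expR (- (n%:R * (F + c / 2))).
have al0 : 0 < al by exact: expR_gt0.
(* AM-GM: 2 Z <= al Z^2 + 1/al whenever Z > 0 *)
have amgm : mean (fun s : hom r n => (Z s)%:R : R) <=
    (al * mean (fun s : hom r n => (Z s)%:R ^+ 2 : R) + al^-1 * mean (fun s : hom r n => (0 < Z s)%N%:R : R)) / 2.
  rewrite -!meanZ [X in _ <= X / 2](_ : _ = mean (fun s : hom r n =>
    al * (Z s)%:R ^+ 2 + al^-1 * (0 < Z s)%N%:R : R)); last by rewrite /mean -mulrDl -big_split.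
  rewrite ler_pdivlMr// mulrC -meanZ; apply: ler_mean => s.
  have [->|Z0] := posnP (Z s); first by rewrite expr0n/= !mulr0 addr0.
  rewrite mulr1 -(ler_pM2l al0) mulrDr divff ?gt_eqF//.
  have := sqr_ge0 (al * (Z s)%:R - 1); nra.
have : expR (n%:R * (F - Num.min delta (c / 2) / 2)) <= expR (n%:R * (F - Num.min delta (c / 2))).
  apply: (le_trans EZ); apply: (le_trans amgm); rewrite ler_pdivrMr// mulr_natr mulr2n.
  apply: lerD.
    apply: (@le_trans _ _ (al * expR (n%:R * (2 * F + c / 2 - delta)))); first by rewrite ler_pM2l.
    rewrite /al -expRD ler_expR.
    have : n%:R * Num.min delta (c / 2) <= n%:R * delta by rewrite ler_pM2l// ge_min lexx.
    lra.
  apply: (@le_trans _ _ (al^-1 * expR (- (c * n%:R)))); first by rewrite ler_pM2l ?invr_gt0.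
  rewrite /al -expRN opprK -expRD ler_expR.
  have : n%:R * Num.min delta (c / 2) <= n%:R * (c / 2) by rewrite ler_pM2l// ge_min lexx orbT.
  lra.
by rewrite ler_expR ler_pM2l//; lra.
Qed.

End SecondMoment.

Theorem theorem3 (R : realType) (r : nat) (epsc : R) (Hc : is_eps_c r epsc)
  (eps : R) (heps0 : 0 < eps) (hepsc : eps < epsc) :
  exists lam : cyl r (bool * bool)%type -> R,
    joining lam (@Ising R r eps) (@Ising R r eps) /\
    (f_inv lam > f_inv (prod_meas (@Ising R r eps) (@Ising R r eps)))%E.
Proof.
(* For [r = 0] the cut fraction is a division by zero, hence 0, which would give [epsc <= 0]. *)
have r0 : (0 < r)%N.
  rewrite lt0n; apply: contraTneq hepsc => r0; rewrite -leNgt (le_trans _ (ltW heps0))//.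
  apply: (eps_c_le Hc) => n s n0.
  by rewrite [X in _ / (X * _)%N%:R]r0 mul0n invr0 mulr0.
(* A cut never exceeds the number of edges, so [epsc <= 1]. *)
have eps1 : eps < 1.
  apply: lt_le_trans hepsc _; apply: (eps_c_le Hc) => n s n0.
  by rewrite ler_pdivrMr ?ltr0n ?muln_gt0 ?r0// mul1r ler_nat mcut_le_edges.
have [c c0 ns] := second_moment_not_small r0 Hc heps0 hepsc eps1.
have [lam [lam0 lamU]] := exists_limit_point ns.
exists lam; split; first exact: (limit_joining lam0 lamU).
apply: le_lt_trans (f_inv_prod_le r heps0 eps1) _.
apply: lt_le_trans (limit_f_inv lamU).
by rewrite lte_fin ltrDl divr_gt0.
Qed.
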